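(* Let $\Delta\ge 0$, let $n\ge 1$ be an integer, and let $f_0:\mathcal X^n\to\mathbb R^n$ be Lipschitz on bounded sets with $f_0(0)=0$. Assume that there exist a functional $V:\mathcal X^n\to\mathbb R_{\ge 0}$ which is Lipschitz on bounded sets, and constants $\overline a,a>0$ and $c\ge 0$ such that, for all $\phi\in\mathcal X^n$, $$0\le V(\phi)\le \overline a\|\phi\|^2,\qquad D^+V(\phi,f_0(\phi))\le -a|\phi(0)|^2+c\|\phi\|^2.$$ Assume further that there exist a symmetric positive definite matrix $P\in\mathbb R^{n\times n}$ and a constant $\sigma>0$ such that, for all $\phi\in\mathcal X^n$, $$\phi(0)^\top P f_0(\phi)\le \sigma\|\phi\|^2.$$ Then there exists $\bar c>0$ such that, if $c\in[0,\bar c)$, the origin of $\dot x(t)=f_0(x_t)$ is globally exponentially stable.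
   Context: $\mathcal X^n$ is the set of continuous functions $\phi:[-\Delta,0]\to\mathbb R^n$, with $\|\phi\|=\max_{\tau\in[-\Delta,0]}|\phi(\tau)|$, where $|\cdot|$ is the Euclidean norm. A map is Lipschitz on bounded sets if its restriction to every bounded set is Lipschitz. For a continuous $x:[-\Delta,T)\to\mathbb R^n$ and $t\in[0,T)$, $x_t\in\mathcal X^n$ is $x_t(\tau):=x(t+\tau)$, $\tau\in[-\Delta,0]$. The solution of $\dot x(t)=f_0(x_t)$ from $x_0\in\mathcal X^n$ is the unique maximal solution. Driver derivative: for $V:\mathcal X^n\to\mathbb R_{\ge 0}$, $\phi\in\mathcal X^n$, $w\in\mathbb R^n$, $D^+V(\phi,w):=\limsup_{h\to 0^+}\frac{V(\phi_{h,w})-V(\phi)}{h}$, where for $h\in[0,\Delta)$, $\phi_{h,w}(s):=\phi(s+h)$ if $s\in[-\Delta,-h)$ and $\phi_{h,w}(s):=\phi(0)+(h+s)w$ if $s\in[-h,0]$. (If $\Delta=0$, $\mathcal X^n$ is identified with $\mathbb R^n$ and $\phi_{h,w}:=\phi(0)+hw$ for $h\geq 0$.) Global exponential stability (GES): the origin of $\dot x(t)=f_0(x_t)$ is GES if there exist $k,\eta>0$ such that, for all $x_0\in\mathcal X^n$, the corresponding solution exists for all $t\ge 0$ and satisfies $|x(t)|\le k\|x_0\|e^{-\eta t}$ for all $t\ge 0$. *)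

(* Defs.v *)
From HB Require Import structures.
From mathcomp Require Import all_boot all_order all_algebra.
From mathcomp Require Import all_classical all_reals all_analysis.

Set Implicit Arguments.
Unset Strict Implicit.
Unset Printing Implicit Defensive.

Import Order.TTheory GRing.Theory Num.Theory.
Import numFieldNormedType.Exports.

Local Open Scope classical_set_scope.
Local Open Scope ring_scope.

(* The topology of 'cV[R]_n is the one of the library's max norm, which is the
   Euclidean topology; quantitative statements use [enorm]. *)
Definition enorm (R : realType) (n : nat) (v : 'cV[R]_n) : R :=
  Num.sqrt (\sum_i v i 0 ^+ 2).

Definition qform (R : realType) (n : nat) (P : 'M[R]_n) (u v : 'cV[R]_n) : R :=
  (u^T *m P *m v) 0 0.

Definition symposdef (R : realType) (n : nat) (P : 'M[R]_n) : Prop :=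
  P^T = P /\ forall v : 'cV[R]_n, v != 0 -> 0 < qform P v v.

(* [hist Delta n] is the space of continuous functions [-Delta, 0] -> R^n.
   An element is stored as a function on the whole line, with the value 0
   outside [-Delta, 0], so that Leibniz equality of elements is equality of
   functions on [-Delta, 0]. *)
Section Hist.
Context (R : realType) (Delta : R) (n : nat).
Implicit Types (g : R -> 'cV[R]_n) (s : R).

Definition is_hist g : Prop :=
  {within `[- Delta, 0]%classic, continuous g} /\
  forall s, ~ `[- Delta, 0]%classic s -> g s = 0.

Definition hist_pred : {pred (R -> 'cV[R]_n)} := mem [set g | is_hist g].

Lemma hist_predP g : reflect (is_hist g) (g \in hist_pred).
Proof.
apply: (iffP idP); first by move=> h; exact: (set_mem h).
by move=> h; apply/mem_set.
Qed.

Lemma hist_submod_closed : submod_closed hist_pred.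
Proof.
split=> [|a g h /hist_predP[cg g0] /hist_predP[ch h0]]; apply/hist_predP.
  by split=> // x; exact: cst_continuous.
split=> [x|s sD]; last by rewrite !fctE g0// h0// scaler0 addr0.
by apply: cvgD; [apply: cvgZl_tmp; exact: cg|exact: ch].
Qed.

HB.instance Definition _ :=
  GRing.isSubmodClosed.Build _ _ hist_pred hist_submod_closed.

Record hist : Type := Hist { hist_fun :> R -> 'cV[R]_n; _ : hist_fun \in hist_pred }.

HB.instance Definition _ := [isSub for hist_fun].
HB.instance Definition _ := [Choice of hist by <:].
HB.instance Definition _ := [SubChoice_isSubLmodule of hist by <:].

Definition hnorm (phi : hist) : R :=
  sup [set enorm (phi s) | s in `[- Delta, 0]%classic].

(* The restriction of [g] to [-Delta, 0]; it is meaningful when [g] is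
   continuous there ([hist_ofE]), and is 0 otherwise. *)
Definition hist_of g : hist :=
  insubd (0 : hist) (patch (cst 0) `[- Delta, 0]%classic g).

Lemma hist_ofE g s : {within `[- Delta, 0]%classic, continuous g} ->
  s \in `[- Delta, 0] -> hist_of g s = g s.
Proof.
move=> cg sD.
have sD' : s \in `[- Delta, 0]%classic by rewrite inE.
rewrite /hist_of -[hist_fun _]/(val _) val_insubd ifT; first by rewrite /patch sD'.
apply/hist_predP; split=> [|u uD]; last first.
  by rewrite /patch ifN//; apply/negP => /set_mem.
by apply: subspace_eq_continuous cg => u uD; rewrite /from_subspace /patch ifT.
Qed.

Definition segment (x : R -> 'cV[R]_n) (t : R) : hist :=
  hist_of (fun tau => x (t + tau)).

(* phi_{h,w}, for small h >= 0. When Delta = 0 the only argument is s = 0 and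
   the formula gives phi(0) + h w. *)
Definition driver_ext (phi : hist) (w : 'cV[R]_n) (h : R) : hist :=
  hist_of (fun s => if s < - h then phi (s + h) else phi 0 + (h + s) *: w).

Definition driver_deriv (V : hist -> R) (phi : hist) (w : 'cV[R]_n) : \bar R :=
  limf_esup (fun h => ((V (driver_ext phi w h) - V phi) / h)%:E) 0^'+.

Definition lipschitz_on_bounded (U : zmodType) (N : U -> R) (f : hist -> U) :=
  forall B : set hist, (exists r, forall phi, B phi -> hnorm phi <= r) ->
  exists L, forall phi psi, B phi -> B psi ->
    N (f phi - f psi) <= L * hnorm (phi - psi).

(* [x] solves x'(t) = f0(x_t) on [0, T) with x_0 = [x0]; the values of [x]
   outside [-Delta, T) are irrelevant. The derivative is one-sided at t = 0. *)
Definition is_solution (f0 : hist -> 'cV[R]_n) (x0 : hist) (T : \bar R)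
    (x : R -> 'cV[R]_n) : Prop :=
  [/\ (0 < T)%E,
      {within [set t | - Delta <= t /\ (t%:E < T)%E], continuous x},
      forall tau, tau \in `[- Delta, 0] -> x tau = x0 tau,
      h^-1 *: (x h - x 0) @[h --> 0^'+] --> f0 (segment x 0) &
      forall t, 0 < t -> (t%:E < T)%E -> is_derive t 1 x (f0 (segment x t))].

Definition is_maximal_solution (f0 : hist -> 'cV[R]_n) (x0 : hist) (T : \bar R)
    (x : R -> 'cV[R]_n) : Prop :=
  is_solution f0 x0 T x /\
  forall (T' : \bar R) (y : R -> 'cV[R]_n), is_solution f0 x0 T' y ->
    (T <= T')%E -> (forall t, - Delta <= t -> (t%:E < T)%E -> y t = x t) ->
    T' = T.

(* The (unique) maximal solution from x0 is rendered by asking that one exists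
   and that every one is global and satisfies the estimate. *)
Definition GES (f0 : hist -> 'cV[R]_n) : Prop :=
  exists k eta : R, [/\ 0 < k, 0 < eta &
    forall x0 : hist,
      (exists T x, is_maximal_solution f0 x0 T x) /\
      forall T x, is_maximal_solution f0 x0 T x ->
        T = +oo%E /\
        forall t, 0 <= t -> enorm (x t) <= k * hnorm x0 * expR (- (eta * t))].

End Hist.

Lemma within_continuous_comp_in (R : realType) (n : nat) (A B : set R)
    (f : R -> R) (g : R -> 'cV[R]_n) :
  continuous f -> (forall s, A s -> B (f s)) -> {within B, continuous g} ->
  {within A, continuous (g \o f)}.
Proof.
move=> cf fAB /subspace_continuousP cg; apply/subspace_continuousP => s As.
apply: (@cvg_comp _ _ _ f g _ (within B (nbhs (f s)))); last exact/cg/fAB.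
move=> U fU; have : nbhs s (f @^-1` [set y | B y -> U y]) := cf s _ fU.
by apply: filterS => u BU Au; exact/BU/fAB.
Qed.

(* The continuity required for [segment] and [driver_ext] to be the intended
   functions does hold. *)
Lemma segmentE (R : realType) (Delta : R) (n : nat) (T : \bar R)
    (x : R -> 'cV[R]_n) (t tau : R) :
  {within [set t | - Delta <= t /\ (t%:E < T)%E], continuous x} ->
  0 <= t -> (t%:E < T)%E -> tau \in `[- Delta, 0] ->
  segment Delta x t tau = x (t + tau).
Proof.
move=> cx t0 tT tauD; rewrite /segment hist_ofE//.
apply: (within_continuous_comp_in _ _ cx) => [|s].
  by move=> s; apply: cvgD; [exact: cvg_cst|exact: cvg_id].
rewrite /= in_itv/= => /andP[sD s0]; split; first by rewrite -[leLHS]add0r lerD.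
by apply: le_lt_trans tT; rewrite lee_fin -[leRHS]addr0 lerD2l.
Qed.

Lemma driver_extE (R : realType) (Delta : R) (n : nat) (phi : hist Delta n)
    (w : 'cV[R]_n) (h s : R) : 0 <= h -> s \in `[- Delta, 0] ->
  driver_ext phi w h s =
    if s < - h then phi (s + h) else phi 0 + (h + s) *: w.
Proof.
move=> h0 sD; rewrite /driver_ext hist_ofE//.
have cphi : {within `[- Delta, 0]%classic, continuous phi}.
  by case: phi => g /= /hist_predP[].
have cadd : continuous (fun u : R => u + h).
  by move=> u; apply: cvgD; [exact: cvg_id|exact: cvg_cst].
pose f (u : R) := Num.min (u + h) 0; pose m (u : R) := Num.max (u + h) 0.
have cf : continuous f.
  by move=> u; apply: (@continuous_min R R (fun u => u + h) (cst 0));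
    [exact: cadd|exact: cst_continuous].
have cm : continuous m.
  by move=> u; apply: (@continuous_max R R (fun u => u + h) (cst 0));
    [exact: cadd|exact: cst_continuous].
have fD u : `[- Delta, 0]%classic u -> `[- Delta, 0]%classic (f u).
  rewrite /= !in_itv/= => /andP[uD u0].
  rewrite /f ge_min lexx orbT andbT le_min (le_trans uD u0) andbT.
  by rewrite (le_trans uD)// lerDl.
have c1 := within_continuous_comp_in cf fD cphi.
have c2 : {within `[- Delta, 0]%classic, continuous (fun u => m u *: w)}.
  by apply: continuous_subspaceT => u; apply: cvgZr_tmp; exact: cm.
have c12 : {within `[- Delta, 0]%classic,
    continuous (fun u => phi (f u) + m u *: w)}.
  by move=> u; apply: cvgD; [exact: c1|exact: c2].
apply: subspace_eq_continuous c12 => u _; rewrite /from_subspace /f /m.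
have -> : (u < - h) = (u + h < 0) by rewrite -ltrBrDr sub0r.
rewrite [h + u]addrC.
by case: ltP => uh; rewrite ?scale0r ?addr0.
Qed.

(* Main.v *)
(** Let [U phi] be the supremum over [s] in [-Delta, 0] of
    [expR s * q (phi s)], where [q v = v^T P v]. Along solutions the past
    contribution to [U] decays at rate 1, and [U] can grow through the present
    value only when it equals [q (phi 0)]; since the growth of [q] is bounded by
    a multiple of [||phi||^2], itself bounded by a multiple of [U], this gives
    [D^+ U <= - U + K q (phi 0)]. For a small [e], the functional [V + e U]
    then absorbs both [a |phi(0)|^2] and, if [c] is small, [c ||phi||^2], is
    comparable to [||phi||^2] and satisfies [D^+ W <= - mu W]. Global existence
    follows by solving the equation truncated outside a ball which, by the decay
    estimate, solutions never leave. *)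

Require Import Defs.
From mathcomp Require Import all_boot all_order all_algebra.
From mathcomp Require Import all_classical all_reals all_analysis.
From mathcomp Require Import ring lra.
Import Order.TTheory GRing.Theory Num.Theory.
Import numFieldNormedType.Exports.
Local Open Scope classical_set_scope.
Local Open Scope ring_scope.

Set Implicit Arguments.
Unset Strict Implicit.
Unset Printing Implicit Defensive.

(** * Quadratic forms and the Euclidean norm *)

(** The dissipation of [V] sees only phi(0), and [V] is merely known to be nonnegative, so [V] alone
    controls neither ||phi|| nor c ||phi||^2; [U] supplies both. Write ||phi||^2 <= E U. Then K = 1
    + 2 sigma E: the 1 cancels - U when q(phi(0)) = U, and 2 sigma E bounds the growth of q. The
    factor e is taken so that e K q(phi(0)) <= a |phi(0)|^2; what remains is - (e - c E) U, whence
    the threshold e / E. The time steps h for which such estimates hold depend on phi, through the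
    gap U - q(phi(0)) and the size of f0(phi), which need not grow linearly. Growth is therefore
    expressed by first-order inequalities at a fixed phi, with an arbitrary error, and turned into
    decay by real induction along a trajectory; absorbing the error costs part of the rate. *)

Section EuclideanNorm.
Context (R : realType) (n : nat).
Implicit Types (P : 'M[R]_n) (u v w : 'cV[R]_n).

Lemma qformDl P u v w : qform P (u + v) w = qform P u w + qform P v w.
Proof. by rewrite /qform linearD/= !mulmxDl mxE. Qed.

Lemma qformDr P u v w : qform P u (v + w) = qform P u v + qform P u w.
Proof. by rewrite /qform mulmxDr mxE. Qed.

Lemma qformZl P c u v : qform P (c *: u) v = c * qform P u v.
Proof. by rewrite /qform linearZ/= -!scalemxAl mxE. Qed.

Lemma qformZr P c u v : qform P u (c *: v) = c * qform P u v.
Proof. by rewrite /qform -scalemxAr mxE. Qed.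

Lemma qform0l P u : qform P 0 u = 0.
Proof. by rewrite -(scale0r 0) qformZl mul0r. Qed.

Lemma qform_sym P u v : P^T = P -> qform P u v = qform P v u.
Proof.
move=> PT; rewrite /qform -[in RHS]PT -[in RHS](trmxK u) -!trmx_mul.
by rewrite [in RHS]mxE mulmxA.
Qed.

Lemma qformDD P u v : P^T = P ->
  qform P (u + v) (u + v) = qform P u u + 2 * qform P u v + qform P v v.
Proof.
by move=> PT; rewrite qformDl !qformDr (qform_sym v u PT) mulr2n mulrDl mul1r !addrA.
Qed.

(* The discriminant of the nonnegative quadratic [t |-> q(u + t v)]. *)
Lemma qform_CauchySchwarz P u v : P^T = P -> (forall w, 0 <= qform P w w) ->
  qform P u v ^+ 2 <= qform P u u * qform P v v.
Proof.
move=> PT P0; set a := qform P u u; set b := qform P u v; set c := qform P v v.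
have key (s t : R) : 0 <= s ^+ 2 * a + 2 * s * t * b + t ^+ 2 * c.
  have := P0 (s *: u + t *: v); rewrite qformDD// !(qformZl, qformZr).
  by congr (0 <= _); rewrite /a /b /c; ring.
have a0 : 0 <= a by exact: P0.
have [c0|] := ltP 0 c.
  have := key c (- b).
  have -> : c ^+ 2 * a + 2 * c * - b * b + (- b) ^+ 2 * c = c * (a * c - b ^+ 2).
    by ring.
  by rewrite pmulr_rge0// subr_ge0.
move=> c0; have {c0}c0 : c = 0 by apply/eqP; rewrite eq_le c0 P0.
(* With c = 0 this choice turns [key] into - (a + 2) b^2 >= 0, which forces b = 0. *)
rewrite c0 mulr0; have := key b (- (a + 1)).
rewrite c0 => h; have := sqr_ge0 b; nra.
Qed.

Lemma enorm_ge0 v : 0 <= enorm v.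
Proof. exact: sqrtr_ge0. Qed.

Lemma enorm_sqr v : enorm v ^+ 2 = \sum_i v i 0 ^+ 2.
Proof. by rewrite sqr_sqrtr// sumr_ge0// => i _; rewrite sqr_ge0. Qed.

Lemma qform1 u v : qform 1%:M u v = \sum_i u i 0 * v i 0.
Proof. by rewrite /qform mulmx1 mxE; apply: eq_bigr => i _; rewrite mxE. Qed.

Lemma enorm_qform v : enorm v ^+ 2 = qform 1%:M v v.
Proof. by rewrite enorm_sqr qform1; apply: eq_bigr => i _; rewrite expr2. Qed.

Lemma enorm0 : enorm (0 : 'cV[R]_n) = 0.
Proof. by rewrite /enorm big1 ?sqrtr0// => i _; rewrite mxE expr0n. Qed.

Lemma enormZ c v : enorm (c *: v) = `|c| * enorm v.
Proof.
rewrite /enorm -sqrtr_sqr -sqrtrM ?sqr_ge0// mulr_sumr; congr Num.sqrt.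
by apply: eq_bigr => i _; rewrite mxE exprMn.
Qed.

Lemma enormN v : enorm (- v) = enorm v.
Proof. by rewrite -scaleN1r enormZ normrN1 mul1r. Qed.

Lemma enorm_distC u v : enorm (u - v) = enorm (v - u).
Proof. by rewrite -enormN opprB. Qed.

Lemma ler_enormD u v : enorm (u + v) <= enorm u + enorm v.
Proof.
have CS : qform 1%:M u v <= enorm u * enorm v.
  have P0 w : 0 <= qform 1%:M w w by rewrite -enorm_qform sqr_ge0.
  have := qform_CauchySchwarz u v (trmx1 _ _) P0.
  rewrite -!enorm_qform -exprMn => h.
  rewrite (le_trans (ler_norm _))// -(@ler_pXn2r _ 2)// ?nnegrE//.
    by rewrite real_normK// num_real.
  by rewrite mulr_ge0// enorm_ge0.
rewrite -(@ler_pXn2r _ 2)// ?nnegrE ?addr_ge0 ?enorm_ge0//.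
rewrite enorm_qform qformDD ?trmx1// -!enorm_qform; nra.
Qed.

Lemma ler_enormB u v : enorm u <= enorm v + enorm (u - v).
Proof. by rewrite -{1}(subrK v u) addrC ler_enormD. Qed.

Lemma ler_dist_enorm u v : `|enorm u - enorm v| <= enorm (u - v).
Proof.
have h1 := ler_enormB u v; have := ler_enormB v u; rewrite enorm_distC => h2.
by rewrite ler_norml; apply/andP; split; lra.
Qed.

Lemma ler_coord_enorm v i : `|v i 0| <= enorm v.
Proof.
rewrite -sqrtr_sqr ler_wsqrtr// (bigD1 i)//= lerDl.
by rewrite sumr_ge0// => j _; rewrite sqr_ge0.
Qed.

Lemma enorm_eq0 v : enorm v <= 0 -> v = 0.
Proof.
move=> v0; apply/matrixP => i j; rewrite ord1 mxE; apply/eqP.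
by rewrite -normr_le0 (le_trans (ler_coord_enorm v i)).
Qed.

Lemma ler_norm_enorm v : `|v| <= enorm v.
Proof.
rewrite /Num.norm/= mx_normrE; apply: bigmax_le => [|[i j] _ /=].
  exact: enorm_ge0.
by rewrite ord1 ler_coord_enorm.
Qed.

Lemma ler_enorm_norm v : enorm v <= Num.sqrt n%:R * `|v|.
Proof.
have v0 : 0 <= Num.sqrt n%:R * `|v| by rewrite mulr_ge0 ?sqrtr_ge0.
rewrite -(@ler_pXn2r _ 2)// ?nnegrE ?enorm_ge0//.
rewrite enorm_sqr exprMn sqr_sqrtr ?ler0n// mulr_natl.
have -> : `|v| ^+ 2 *+ n = \sum_(i < n) `|v| ^+ 2 by rewrite sumr_const card_ord.
apply: ler_sum => i _; rewrite -real_normK ?num_real//.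
rewrite ler_pXn2r// ?nnegrE//.
rewrite /Num.norm/= mx_normrE.
exact: (le_bigmax 0 (fun ij : 'I_n * 'I_1 => `|v ij.1 ij.2|) (i, 0)).
Qed.

(** A crude bound for the operator norm; the summand 1 makes it positive, so that it can be divided
    by. *)
Definition mxsum P : R := 1 + \sum_i \sum_j `|P i j|.

Lemma mxsum_gt0 P : 0 < mxsum P.
Proof.
by rewrite /mxsum ltr_pwDl// sumr_ge0// => i _; rewrite sumr_ge0.
Qed.

Lemma ler_qform P u v : `|qform P u v| <= mxsum P * (enorm u * enorm v).
Proof.
have -> : qform P u v = \sum_i \sum_j u i 0 * P i j * v j 0.
  rewrite /qform mxE exchange_big/=; apply: eq_bigr => j _.
  by rewrite mxE mulr_suml; apply: eq_bigr => i _; rewrite mxE.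
apply: le_trans (ler_norm_sum _ _ _) _.
rewrite /mxsum mulrDl mul1r ler_wpDl ?mulr_ge0 ?enorm_ge0// mulr_suml.
apply: ler_sum => i _; apply: le_trans (ler_norm_sum _ _ _) _.
rewrite mulr_suml; apply: ler_sum => j _.
rewrite !normrM mulrAC mulrC ler_wpM2l//.
by rewrite ler_pM// ler_coord_enorm.
Qed.

Lemma symposdef_ge0 P v : symposdef P -> 0 <= qform P v v.
Proof.
move=> [_ P0]; have [->|/P0/ltW//] := eqVneq v 0.
by rewrite qform0l.
Qed.

Lemma symposdef_unit P : symposdef P -> P \in unitmx.
Proof.
move=> [PT P0]; rewrite unitmxE unitfE; apply/det0P => -[v v0 vP].
have /P0 : v^T != 0 by rewrite -(inj_eq trmx_inj) trmxK trmx0.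
by rewrite /qform trmxK vP mul0mx mxE ltxx.
Qed.

(* [|v|^2] is the [P]-product of [v] and [P^-1 v], to which Cauchy-Schwarz
   applies. *)
Lemma symposdef_coercive P : symposdef P ->
  exists2 C, 0 < C & forall v, enorm v ^+ 2 <= C * qform P v v.
Proof.
move=> Ppos; have [PT _] := Ppos; have Pu := symposdef_unit Ppos.
exists (mxsum (invmx P)); first exact: mxsum_gt0.
move=> v; have P0 w := symposdef_ge0 w Ppos.
have := qform_CauchySchwarz v (invmx P *m v) PT P0.
have -> : qform P v (invmx P *m v) = enorm v ^+ 2.
  by rewrite enorm_qform /qform -!mulmxA mulKVmx// mul1mx.
have -> : qform P (invmx P *m v) (invmx P *m v) = qform (invmx P) v v.
  by rewrite /qform trmx_mul trmx_inv PT -!mulmxA mulKVmx.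
have := ler_qform (invmx P) v v; set C := mxsum _; set q := qform P v v.
set e := enorm v => /(le_trans (ler_norm _)) h1 h2.
have q0 : 0 <= q by exact: P0.
have h3 : (e ^+ 2) ^+ 2 <= q * (C * (e * e)) := le_trans h2 (ler_wpM2l q0 h1).
have [e0|] := ltP 0 e; last first.
  move=> e0; have -> : e = 0 by apply/eqP; rewrite eq_le e0 enorm_ge0.
  by rewrite expr0n/= mulr_ge0// ltW// mxsum_gt0.
have e2 : 0 < e ^+ 2 by rewrite exprn_gt0.
rewrite -(ler_pM2r e2); rewrite expr2 in h3; apply: le_trans h3 _.
by rewrite le_eqVlt; apply/orP; left; apply/eqP; ring.
Qed.

End EuclideanNorm.

(** * Histories *)

Lemma continuous_enorm (R : realType) (n : nat) : continuous (@enorm R n).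
Proof.
move=> v; apply/(@cvgrPdist_le _ _ _ (nbhs v)) => e e0.
have K0 : 0 < Num.sqrt n%:R + 1 :> R by rewrite ltr_wpDl// sqrtr_ge0.
have d0 : 0 < e / (Num.sqrt n%:R + 1) by rewrite divr_gt0.
have /cvgrPdist_le/(_ _ d0) : w @[w --> v] --> v by exact: cvg_id.
apply: filterS => w h; apply: le_trans (ler_dist_enorm _ _) _.
apply: le_trans (ler_enorm_norm _) _.
apply: le_trans (ler_wpM2l (sqrtr_ge0 _) h) _.
by rewrite mulrCA ger_pMr// ler_pdivrMr// mul1r lerDl.
Qed.

Section Histories.
Context (R : realType) (Delta : R) (n : nat) (Delta_ge0 : 0 <= Delta).
Implicit Types (phi psi : hist Delta n) (s t : R) (x y : R -> 'cV[R]_n).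

Lemma hist_continuous phi : {within `[- Delta, 0], continuous phi}.
Proof. by case: phi => g /= /hist_predP[]. Qed.

Lemma hist_of_eq (g h : R -> 'cV[R]_n) :
  {in `[- Delta, 0], g =1 h} -> hist_of Delta g = hist_of Delta h.
Proof.
move=> gh; rewrite /hist_of; congr insubd; apply/funext => s.
by rewrite /patch; case: ifPn => // /set_mem/= /gh.
Qed.

Lemma histP phi psi : {in `[- Delta, 0], phi =1 psi} -> phi = psi.
Proof.
move=> e; apply/val_inj/funext => s /=.
have [/e//|sD] := boolP (s \in `[- Delta, 0]).
case: phi e => g /= /hist_predP[_ g0] _; case: psi => h /= /hist_predP[_ h0].
by rewrite g0 ?h0//=; exact/negP.
Qed.

Lemma zero_in_delay : 0 \in `[- Delta, 0].
Proof. by rewrite in_itv/= oppr_le0 Delta_ge0 lexx. Qed.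

Lemma le_sup_delay (g : R -> R) M s : {in `[- Delta, 0], forall r, g r <= M} ->
  s \in `[- Delta, 0] -> g s <= sup [set g r | r in `[- Delta, 0]%classic].
Proof.
move=> gM sD; apply: ub_le_sup; last by exists s.
by exists M => _ [r rD <-]; exact: gM.
Qed.

Lemma sup_delay_le (g : R -> R) M : {in `[- Delta, 0], forall r, g r <= M} ->
  sup [set g r | r in `[- Delta, 0]%classic] <= M.
Proof.
move=> gM; apply: ge_sup.
  by exists (g 0), 0 => //; exact: zero_in_delay.
by move=> _ [r rD <-]; exact: gM.
Qed.

Lemma hist_bounded phi :
  exists M, {in `[- Delta, 0], forall s, enorm (phi s) <= M}.
Proof.
have cphi : {within `[- Delta, 0], continuous (@enorm R n \o phi)}.
  move=> s; apply: (@continuous_comp (subspace `[- Delta, 0]) 'cV[R]_n R phi).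
    exact: hist_continuous.
  exact: continuous_enorm.
have /compact_bounded[M [_ HM]] :=
  continuous_compact cphi (@segment_compact R (- Delta) 0).
exists (M + 1) => s sD.
rewrite -[leLHS]ger0_norm ?enorm_ge0//.
by apply: (HM (M + 1)); [rewrite ltrDl|exists s].
Qed.

Lemma le_hnorm phi s : s \in `[- Delta, 0] -> enorm (phi s) <= hnorm phi.
Proof.
have [M HM] := hist_bounded phi.
exact: (le_sup_delay (g := fun r => enorm (phi r)) HM).
Qed.

Lemma hnorm_le phi M :
  {in `[- Delta, 0], forall s, enorm (phi s) <= M} -> hnorm phi <= M.
Proof. exact: sup_delay_le. Qed.

Lemma hnorm_ge0 phi : 0 <= hnorm phi.
Proof. exact: le_trans (enorm_ge0 _) (le_hnorm phi zero_in_delay). Qed.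

Lemma histDE phi psi s : (phi + psi) s = phi s + psi s.
Proof. by []. Qed.

Lemma histNE phi s : (- phi) s = - phi s.
Proof. by []. Qed.

Lemma histBE phi psi s : (phi - psi) s = phi s - psi s.
Proof. by []. Qed.

Lemma hnorm0 : hnorm (0 : hist Delta n) = 0.
Proof.
apply/eqP; rewrite eq_le hnorm_ge0 andbT; apply: hnorm_le => s _.
by rewrite enorm0.
Qed.

Lemma ler_hnormD phi psi : hnorm (phi + psi) <= hnorm phi + hnorm psi.
Proof.
apply: hnorm_le => s sD; rewrite histDE (le_trans (ler_enormD _ _))//.
by rewrite lerD// le_hnorm.
Qed.

Lemma hnormZ_le (c : R) phi : hnorm (c *: phi) <= `|c| * hnorm phi.
Proof. by apply: hnorm_le => s sD; rewrite enormZ ler_wpM2l// le_hnorm. Qed.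

Lemma hnormN phi : hnorm (- phi) = hnorm phi.
Proof.
by rewrite /hnorm; congr sup; apply: eq_imagel => s _; rewrite histNE enormN.
Qed.

Lemma hnorm_distC phi psi : hnorm (phi - psi) = hnorm (psi - phi).
Proof. by rewrite -hnormN opprB. Qed.

Lemma ler_hnormB phi psi : hnorm phi <= hnorm psi + hnorm (phi - psi).
Proof. by rewrite -{1}(subrK psi phi) addrC ler_hnormD. Qed.

Lemma ler_dist_hnorm phi psi : `|hnorm phi - hnorm psi| <= hnorm (phi - psi).
Proof.
have h1 := ler_hnormB phi psi; have := ler_hnormB psi phi; rewrite hnorm_distC => h2.
by rewrite ler_norml; apply/andP; split; lra.
Qed.

Lemma lipschitz_hnorm : lipschitz_on_bounded (fun r : R => `|r|) (@hnorm R Delta n).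
Proof.
by move=> B _; exists 1 => phi psi _ _; rewrite mul1r ler_dist_hnorm.
Qed.

Lemma lipschitz_ball (U : zmodType) (N : U -> R) (f : hist Delta n -> U) r :
  lipschitz_on_bounded N f -> exists2 L, 0 < L &
    forall phi psi, hnorm phi <= r -> hnorm psi <= r ->
      N (f phi - f psi) <= L * hnorm (phi - psi).
Proof.
move=> /(_ [set phi | hnorm phi <= r])[|L HL]; first by exists r.
(* The given constant may have any sign; this one is positive. *)
exists (`|L| + 1) => [|phi psi phir psir]; first by rewrite ltr_wpDl.
apply: le_trans (HL _ _ phir psir) _; apply: ler_wpM2r; first exact: hnorm_ge0.
by rewrite (le_trans (ler_norm L))// lerDl.
Qed.

Lemma segment_shiftE x t s : continuous x -> s \in `[- Delta, 0] ->
  segment Delta x t s = x (t + s).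
Proof.
move=> cx sD; rewrite /segment hist_ofE//; apply: continuous_subspaceT => u.
apply: (@continuous_comp _ _ _ (fun u : R => t + u) x); last exact: cx.
by apply: cvgD; [exact: cvg_cst|exact: cvg_id].
Qed.

Lemma segmentB x y t : continuous x -> continuous y ->
  segment Delta (x \- y) t = segment Delta x t - segment Delta y t.
Proof.
move=> cx cy; apply: histP => s sD; rewrite histBE !segment_shiftE//.
by move=> u; apply: cvgB; [exact: cx|exact: cy].
Qed.

Lemma segment_hnorm_le x t M : continuous x ->
  (forall u, t - Delta <= u <= t -> enorm (x u) <= M) ->
  hnorm (segment Delta x t) <= M.
Proof.
move=> cx xM; apply: hnorm_le => s sD; rewrite segment_shiftE//; apply: xM.
by move: sD; rewrite in_itv/= => /andP[? ?]; rewrite lerD2l gerDl; apply/andP.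
Qed.

Lemma enorm_le_segment x t : continuous x ->
  enorm (x t) <= hnorm (segment Delta x t).
Proof.
move=> cx; have := le_hnorm (segment Delta x t) zero_in_delay.
by rewrite segment_shiftE ?addr0// zero_in_delay.
Qed.

(** Compactness of [-Delta, 0], in its near-covering form, makes the continuity of [x] at each t + s
    uniform in s. *)
Lemma near_segment x t e : continuous x -> 0 < e ->
  \forall u \near t, hnorm (segment Delta x u - segment Delta x t) <= e.
Proof.
move=> cx e0; have e20 : 0 < e / 2 by rewrite divr_gt0.
have /compact_near_coveringP cov := @segment_compact R (- Delta) 0.
have : \forall u \near nbhs t, `[- Delta, 0]%classic `<=`
    (fun s => enorm (x (u + s) - x (t + s)) <= e).
  apply: (cov _ (nbhs t) (fun u s => enorm (x (u + s) - x (t + s)) <= e)) => s sD.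
  have c1 : enorm (x (p.2 + p.1) - x (t + p.1)) @[p --> (s, t)] --> enorm (x (t + s) - x (t + s)).
    apply: (@cvg_comp _ _ _ (fun p : R * R => x (p.2 + p.1) - x (t + p.1))
      (@enorm R n) _ (nbhs (x (t + s) - x (t + s)))); last first.
      exact: continuous_enorm.
    apply: cvgB.
      apply: (@cvg_comp _ _ _ (fun p : R * R => p.2 + p.1) x _ (nbhs (t + s))).
        by apply: cvgD; [exact: cvg_snd|exact: cvg_fst].
      exact: cx.
    apply: (@cvg_comp _ _ _ (fun p : R * R => t + p.1) x _ (nbhs (t + s))).
      by apply: cvgD; [exact: cvg_cst|exact: cvg_fst].
    exact: cx.
  rewrite subrr enorm0 in c1.
  move/cvgrPdist_le: c1 => /(_ _ e0); apply: filterS => p /=.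
  by rewrite sub0r normrN ger0_norm// enorm_ge0.
apply: filterS => u hu; apply: hnorm_le => s sD.
by rewrite histBE !segment_shiftE//; exact: hu.
Qed.

Lemma near_lipschitz_segment (U : zmodType) (N : U -> R)
    (f : hist Delta n -> U) x t e :
  lipschitz_on_bounded N f -> continuous x -> 0 < e ->
  \forall u \near t, N (f (segment Delta x u) - f (segment Delta x t)) <= e.
Proof.
move=> lf cx e0.
have [L L0 HL] := lipschitz_ball (hnorm (segment Delta x t) + 1) lf.
have eL : 0 < e / L by rewrite divr_gt0.
near=> u; have h1 : hnorm (segment Delta x u - segment Delta x t) <= 1.
  by near: u; exact: near_segment.
have h2 : hnorm (segment Delta x u - segment Delta x t) <= e / L.
  by near: u; exact: near_segment.
apply: (le_trans (HL _ _ _ _)).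
- by rewrite (le_trans (ler_hnormB _ (segment Delta x t)))// lerD2l.
- by rewrite lerDl.
- by rewrite mulrC -ler_pdivlMr.
Unshelve. all: by end_near. Qed.

Lemma continuous_functional_segment (W : hist Delta n -> R) x :
  lipschitz_on_bounded (fun r : R => `|r|) W -> continuous x ->
  continuous (fun t => W (segment Delta x t)).
Proof.
move=> lW cx t; apply/cvgrPdist_le => e e0.
by have := near_lipschitz_segment t lW cx e0; apply: filterS => u; rewrite distrC.
Qed.

Lemma continuous_field_segment (f : hist Delta n -> 'cV[R]_n) x :
  lipschitz_on_bounded (@enorm R n) f -> continuous x ->
  continuous (fun t => f (segment Delta x t)).
Proof.
move=> lf cx t; apply/cvgrPdist_le => e e0.
have := near_lipschitz_segment t lf cx e0; apply: filterS => u h.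
by rewrite (le_trans (ler_norm_enorm _))// enorm_distC.
Qed.

End Histories.

(** * Comparison and Dini derivatives *)

Section RightNeighborhoods.
Context (R : realType).
Implicit Types (P : set R) (t e M : R).

Lemma near_at_right0P P : (\forall h \near 0^'+, P h) <->
  exists2 d, 0 < d & forall h, 0 < h < d -> P h.
Proof.
split=> [|[d d0 dP]].
  rewrite /at_right /= near_withinE => /nbhs_ballP[d /= d0 dP].
  exists d => // h /andP[h0 hd]; apply: dP => //.
  by rewrite /ball/= sub0r normrN gtr0_norm.
near=> h; apply: dP; apply/andP; split; near: h.
  exact: nbhs_right_gt.
exact: nbhs_right_lt.
Unshelve. all: by end_near. Qed.

Lemma near_right_shift P t :
  (\forall u \near t, P u) -> \forall h \near 0^'+, P (t + h).
Proof.
move=> Pt; apply: (nbhs_right0P t P).1; rewrite /at_right near_withinE.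
by near=> u; move=> _; near: u.
Unshelve. all: by end_near. Qed.

Lemma near_right_mul_le M e : 0 < e -> \forall h \near 0^'+, h * M <= e.
Proof.
move=> e0; apply/near_at_right0P; exists (e / (`|M| + 1)).
  by rewrite divr_gt0// ltr_wpDl.
move=> h /andP[h0]; rewrite ltr_pdivlMr ?ltr_wpDl// => he.
apply: le_trans (ltW he); rewrite ler_wpM2l ?(ltW h0)//.
by rewrite (le_trans (ler_norm _))// lerDl.
Qed.

(* Real induction: the set of [t] such that [D <= z] on [0, t] is closed, and
   open on the right by hypothesis. *)
Lemma comparison (D z : R -> R) (T : R) : continuous D -> continuous z ->
  D 0 <= z 0 ->
  (forall t, 0 <= t < T -> (forall s, 0 <= s <= t -> D s <= z s) ->
    \forall h \near 0^'+, D (t + h) <= z (t + h)) ->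
  forall t, 0 <= t <= T -> D t <= z t.
Proof.
move=> cD cz D0 step t0 /andP[t00 t0T]; rewrite leNgt; apply/negP => Dt0.
pose S := [set t | 0 <= t <= t0 /\ forall s, 0 <= s <= t -> D s <= z s].
have S0 : S 0.
  by split=> [|s]; rewrite ?lexx// => /le_anti <-.
have Sub : has_ubound S by exists t0 => t [/andP[]].
have supS : has_sup S by split => //; exists 0.
set tau := sup S.
have tau0 : 0 <= tau by exact: ub_le_sup.
have taut0 : tau <= t0 by apply: ge_sup; [exists 0|move=> t [/andP[]]].
have lt_tau s : 0 <= s < tau -> D s <= z s.
  move=> /andP[s0 stau]; have [|t [_ tP]] := @sup_adherent _ S (tau - s) _ supS.
    by rewrite subr_gt0.
  by rewrite subKr => st; apply: tP; rewrite s0 ltW.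
have Dtau : D tau <= z tau.
  have [<-//|tau_gt0] := eqVneq 0 tau.
  have {tau_gt0} tau_gt0 : 0 < tau by rewrite lt_neqAle tau_gt0.
  rewrite leNgt; apply/negP => zD.
  have cDz : continuous (D \- z) by move=> u; apply: cvgB; [exact: cD|exact: cz].
  have [d /= d0 dP] : \forall u \near tau, 0 < (D \- z) u.
    by apply: (cvgr_gt ((D \- z) tau) (cDz tau)); rewrite subr_gt0.
  pose s := Num.max 0 (tau - d / 2).
  have sE : 0 <= s < tau.
    by rewrite /s le_max lexx/= gt_max tau_gt0/= gtrBl divr_gt0.
  have := lt_tau _ sE; apply/negP; rewrite -ltNge -subr_gt0.
  apply: dP => /=; move/andP: sE => [_ st].
  rewrite gtr0_norm ?subr_gt0//.
  have : tau - d / 2 <= s by rewrite /s le_max lexx orbT.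
  by move: d0; lra.
have tau_lt : tau < t0.
  rewrite lt_neqAle taut0 andbT; apply/eqP => e.
  by move: Dtau; rewrite e leNgt Dt0.
have le_tau s : 0 <= s <= tau -> D s <= z s.
  move=> /andP[s0]; rewrite le_eqVlt => /predU1P[->//|st].
  by apply: lt_tau; rewrite s0.
have /near_at_right0P[d d0 dP] : \forall h \near 0^'+, D (tau + h) <= z (tau + h).
  by apply: step => //; rewrite tau0 (lt_le_trans tau_lt).
pose r := Num.min (d / 2) (t0 - tau).
have r0 : 0 < r by rewrite /r lt_min divr_gt0//= subr_gt0.
have : S (tau + r).
  split=> [|s /andP[s0 sr]].
    by rewrite addr_ge0 ?(ltW r0)//= addrC -lerBrDr /r ge_min lexx orbT.
  have [st|ts] := leP s tau; first by apply: le_tau; rewrite s0.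
  rewrite -(subrKC tau s); apply: dP; rewrite subr_gt0 ts/=.
  have : r <= d / 2 by rewrite /r ge_min lexx.
  by move: d0 sr; lra.
move=> /(ub_le_sup Sub); rewrite -/tau; lra.
Qed.

End RightNeighborhoods.

Section DiniGrowth.
Context (R : realType) (Delta : R) (n : nat) (Delta_ge0 : 0 <= Delta).
Implicit Types (phi psi : hist Delta n) (w : 'cV[R]_n) (x : R -> 'cV[R]_n).
Implicit Types (V W : hist Delta n -> R) (f : hist Delta n -> 'cV[R]_n).

(** The little-o form avoids division by h; [right_derivativeP] relates it to the limit of
    difference quotients. The right-hand version matches the Driver derivative and makes sense at t
    = 0. *)
Definition right_derivative x (t : R) w := forall e, 0 < e ->
  \forall h \near 0^'+, enorm (x (t + h) - x t - h *: w) <= e * h.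

(** On s < - h the two histories coincide. On [-h, 0] they differ by the first-order remainder of
    [x] at the increment h + s, which is at most e (h + s) <= e h. *)
Lemma near_segment_driver_ext x t w e : continuous x ->
  right_derivative x t w -> 0 < e -> \forall h \near 0^'+,
    hnorm (segment Delta x (t + h) - driver_ext (segment Delta x t) w h) <= e * h.
Proof.
move=> cx xw e0; have /near_at_right0P[d d0 dP] := xw _ e0.
apply/near_at_right0P; exists d => // h /andP[h0 hd].
apply: (hnorm_le Delta_ge0) => s sD.
rewrite histBE driver_extE ?(ltW h0)// (segment_shiftE _ cx sD).
rewrite (segment_shiftE _ cx (zero_in_delay Delta_ge0)).
case: ltP => hs.
  rewrite segment_shiftE//; last first.
    by move: sD; rewrite !in_itv/= => /andP[s1 s2]; apply/andP; split; lra.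
  by rewrite addrAC addrA subrr enorm0 mulr_ge0// ltW.
rewrite addr0 -(addrA t h s) opprD (addrA (x _)).
have hs0 : 0 <= h + s by lra.
have hsh : h + s <= h by move: sD; rewrite in_itv/= => /andP[_ s0]; lra.
apply: le_trans (ler_wpM2l (ltW e0) hsh).
(* The increment 0 is treated apart, since [right_derivative] speaks of positive ones only. *)
move: hs0 hsh; set u := h + s; rewrite le_eqVlt => /predU1P[<- _|u0 uh].
  by rewrite addr0 subrr scale0r subr0 enorm0 mulr0.
by apply: dP; rewrite u0 (le_lt_trans uh).
Qed.

(** An epsilon form of D^+ W(phi, w) <= A: such bounds add up without handling limsups in the
    extended reals. *)
Definition upper_growth W phi w (A : R) := forall e, 0 < e ->
  \forall h \near 0^'+, W (driver_ext phi w h) <= W phi + h * (A + e).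

(** The true history at t + h and its driver extension are o(h) apart, so a locally Lipschitz [W]
    has the same first-order growth on both. Half of e pays for this gap, half for the growth
    bound. *)
Lemma upper_growth_segment W x t w A :
  lipschitz_on_bounded (fun r : R => `|r|) W -> continuous x ->
  right_derivative x t w -> upper_growth W (segment Delta x t) w A ->
  forall e, 0 < e -> \forall h \near 0^'+,
    W (segment Delta x (t + h)) <= W (segment Delta x t) + h * (A + e).
Proof.
move=> lW cx xw gW e e0; have e20 : 0 < e / 2 by rewrite divr_gt0.
(* Margin 2: x_(t+h) will be within 1 of x_t, and the driver extension within 1 of x_(t+h). *)
have [L L0 HL] := lipschitz_ball Delta_ge0 (hnorm (segment Delta x t) + 2) lW.
have eL : 0 < e / 2 / L by rewrite divr_gt0.
near=> h.
have h0 : 0 < h by near: h; exact: nbhs_right_gt.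
have h1 : hnorm (segment Delta x (t + h) - segment Delta x t) <= 1.
  near: h; apply: (near_right_shift
    (P := fun u => hnorm (segment Delta x u - segment Delta x t) <= 1)).
  exact: near_segment.
have h2 : hnorm (segment Delta x (t + h) - driver_ext (segment Delta x t) w h)
    <= e / 2 / L * h.
  by near: h; exact: near_segment_driver_ext.
have h3 : h * (e / 2 / L) <= 1 by near: h; exact: near_right_mul_le.
have h4 : W (driver_ext (segment Delta x t) w h) <=
    W (segment Delta x t) + h * (A + e / 2) by near: h; exact: gW.
move: h1 h2 h4; set phi := segment Delta x t; set psi := segment _ _ (t + h).
set chi := driver_ext phi w h => h1 h2 h4.
have psi_le : hnorm psi <= hnorm phi + 1.
  by rewrite (le_trans (ler_hnormB Delta_ge0 _ phi))// lerD2l.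
have chi_le : hnorm chi <= hnorm phi + 2.
  by have := ler_hnormB Delta_ge0 chi psi; rewrite (hnorm_distC chi); lra.
have := HL psi chi ltac:(lra) chi_le.
move=> /(le_trans (ler_norm _)) h5.
have h6 : L * hnorm (psi - chi) <= h * (e / 2).
  apply: le_trans (ler_wpM2l (ltW L0) h2) _.
  by rewrite mulrA (mulrC L) divfK ?gt_eqF// mulrC.
lra.
Unshelve. all: by end_near. Qed.

Lemma upper_growth_driver_deriv V phi w A :
  (driver_deriv V phi w <= A%:E)%E -> upper_growth V phi w A.
Proof.
move=> VA e e0; have : (driver_deriv V phi w < (A + e)%:E)%E.
  by apply: le_lt_trans VA _; rewrite lte_fin ltrDl.
rewrite /driver_deriv limf_esupE => /ereal_inf_lt[_ [S nS <-]] supS.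
near=> h; have h0 : 0 < h by near: h; exact: nbhs_right_gt.
have Sh : S h by near: h.
have : (((V (driver_ext phi w h) - V phi) / h)%:E < (A + e)%:E)%E.
  by apply: le_lt_trans supS; apply: ereal_sup_ubound; exists h.
by rewrite lte_fin ltr_pdivrMr// mulrC -lerBlDl => /ltW.
Unshelve. all: by end_near. Qed.

End DiniGrowth.

(** * The weighted supremum functional *)

Section WeightedSup.
Context (R : realType) (Delta : R) (n : nat) (Delta_ge0 : 0 <= Delta).
Context (P : 'M[R]_n) (Ppos : symposdef P).
Implicit Types (phi psi : hist Delta n) (w : 'cV[R]_n).

Definition wsup phi : R :=
  sup [set expR s * qform P (phi s) (phi s) | s in `[- Delta, 0]%classic].

Let q_ge0 v : 0 <= qform P v v. Proof. exact: symposdef_ge0. Qed.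

Let exp_delay_le1 s : s \in `[- Delta, 0] -> expR s <= 1.
Proof. by rewrite in_itv/= => /andP[_ s0]; rewrite -expR0 ler_expR. Qed.

Let wq_le phi s : s \in `[- Delta, 0] ->
  expR s * qform P (phi s) (phi s) <= mxsum P * hnorm phi ^+ 2.
Proof.
move=> sD; apply: le_trans (ler_piMl (q_ge0 _) (exp_delay_le1 sD)) _.
apply: le_trans (ler_norm _) _; apply: le_trans (ler_qform _ _ _) _.
rewrite ler_wpM2l ?(ltW (mxsum_gt0 P))// expr2.
by rewrite ler_pM ?enorm_ge0// le_hnorm.
Qed.

Lemma le_wsup phi s : s \in `[- Delta, 0] ->
  expR s * qform P (phi s) (phi s) <= wsup phi.
Proof.
exact: (le_sup_delay (g := fun s => expR s * qform P (phi s) (phi s)) (@wq_le phi)).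
Qed.

Lemma wsup_le phi M :
  {in `[- Delta, 0], forall s, expR s * qform P (phi s) (phi s) <= M} ->
  wsup phi <= M.
Proof. exact: sup_delay_le. Qed.

Lemma qform_le_wsup phi : qform P (phi 0) (phi 0) <= wsup phi.
Proof. by have := le_wsup phi (zero_in_delay Delta_ge0); rewrite expR0 mul1r. Qed.

Lemma wsup_ge0 phi : 0 <= wsup phi.
Proof. exact: le_trans (q_ge0 _) (qform_le_wsup phi). Qed.

Lemma wsup_le_hnorm phi : wsup phi <= mxsum P * hnorm phi ^+ 2.
Proof. exact/wsup_le/wq_le. Qed.

(** The weight is at least [expR (- Delta)] on the delay interval, so removing it costs a factor
    [expR Delta]. *)
Lemma hnorm_le_wsup C phi : 0 < C ->
  (forall v, enorm v ^+ 2 <= C * qform P v v) ->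
  hnorm phi ^+ 2 <= C * expR Delta * wsup phi.
Proof.
move=> C0 HC; have CE0 : 0 <= C * expR Delta by rewrite mulr_ge0 ?expR_ge0// ltW.
have M0 := mulr_ge0 CE0 (wsup_ge0 phi).
rewrite -[leRHS]sqr_sqrtr//.
rewrite ler_pXn2r// ?nnegrE ?hnorm_ge0 ?sqrtr_ge0//.
apply: (hnorm_le Delta_ge0) => s sD.
rewrite -(@ler_pXn2r _ 2)// ?nnegrE ?enorm_ge0 ?sqrtr_ge0//.
rewrite [leRHS]sqr_sqrtr//.
apply: le_trans (HC _) _.
rewrite -mulrA ler_wpM2l ?(ltW C0)//.
have -> : qform P (phi s) (phi s) =
    expR (- s) * (expR s * qform P (phi s) (phi s)).
  by rewrite mulrA -expRD addNr expR0 mul1r.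
apply: ler_pM; rewrite ?mulr_ge0 ?expR_ge0 ?le_wsup// ler_expR.
by move: sD; rewrite in_itv/= => /andP[? _]; rewrite lerNl.
Qed.

(** For the bilinear form b of P, q(u) - q(v) = b(u - v, u) + b(u - v, v), and each term is at most
    [mxsum P * r] times the distance. Weights at most 1 preserve this, and so does the supremum. *)
Lemma lipschitz_wsup : lipschitz_on_bounded (fun r : R => `|r|) wsup.
Proof.
move=> B [r Br]; exists (2 * mxsum P * r).
have key phi psi : B phi -> B psi ->
    wsup phi <= wsup psi + 2 * mxsum P * r * hnorm (phi - psi).
  move=> Bphi Bpsi; apply: wsup_le => s sD.
  have r0 : 0 <= r by exact: le_trans (hnorm_ge0 Delta_ge0 phi) (Br _ Bphi).
  have phir := le_trans (le_hnorm phi sD) (Br _ Bphi).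
  have psir := le_trans (le_hnorm psi sD) (Br _ Bpsi).
  have dle : enorm (phi s - psi s) <= hnorm (phi - psi).
    by have := le_hnorm (phi - psi) sD; rewrite histBE.
  have qE : qform P (phi s) (phi s) = qform P (psi s) (psi s)
      + (qform P (phi s - psi s) (phi s) + qform P (phi s - psi s) (psi s)).
    rewrite !qformDl -scaleN1r !qformZl (qform_sym (phi s) (psi s) Ppos.1).
    by ring.
  have h v : enorm v <= r -> qform P (phi s - psi s) v <=
      mxsum P * r * hnorm (phi - psi).
    move=> vr; apply: le_trans (ler_norm _) _; apply: le_trans (ler_qform _ _ _) _.
    rewrite -mulrA ler_wpM2l ?(ltW (mxsum_gt0 P))// mulrC.
    by rewrite ler_pM ?enorm_ge0.
  rewrite qE mulrDr lerD ?le_wsup//.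
  have sum0 : 0 <= 2 * mxsum P * r * hnorm (phi - psi).
    by rewrite !mulr_ge0 ?hnorm_ge0// ltW// mxsum_gt0.
  have e1 := exp_delay_le1 sD.
  apply: le_trans (ler_wpM2l (expR_ge0 s) (lerD (h _ phir) (h _ psir))) _.
  rewrite [X in _ * X](_ : _ = 2 * mxsum P * r * hnorm (phi - psi)); last by ring.
  exact: ler_piMl.
move=> phi psi Bphi Bpsi; have h1 := key _ _ Bphi Bpsi.
have h2 := key _ _ Bpsi Bphi; rewrite hnorm_distC// in h2.
by rewrite ler_norml; apply/andP; split; lra.
Qed.

(* Shifting contracts the contribution of the past by [expR (- h)], and the
   present value contributes to [wsup] for small [h] only if [q (phi 0)] already
   equals it, in which case the two terms [wsup phi] cancel. *)
Lemma upper_growth_wsup phi w (sigma E : R) : 0 <= sigma ->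
  hnorm phi ^+ 2 <= E * wsup phi -> 0 <= E ->
  qform P (phi 0) w <= sigma * hnorm phi ^+ 2 ->
  upper_growth wsup phi w
    (- wsup phi + (1 + 2 * sigma * E) * qform P (phi 0) (phi 0)).
Proof.
move=> sigma0 phiE E0 qw e e0.
set U := wsup phi in phiE *; set q0 := qform P (phi 0) (phi 0).
set k := 2 * sigma * E; set Q := qform P w w.
have k0 : 0 <= k by rewrite !mulr_ge0.
have q00 : 0 <= q0 by exact: q_ge0.
have U0 : 0 <= U by exact: wsup_ge0.
have Q0 : 0 <= Q by exact: q_ge0.
have q0U : q0 <= U by exact: qform_le_wsup.
(* The only first-order term is 2 r phi(0)^T P w, which the hypothesis on sigma bounds; [Q] depends
   on [w], but enters at second order. *)
have lin r : 0 <= r -> qform P (phi 0 + r *: w) (phi 0 + r *: w) <=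
    q0 + r * (k * U) + r ^+ 2 * Q.
  move=> r0; rewrite qformDD ?Ppos.1// !(qformZl, qformZr) -/q0 -/Q.
  have h1 : 2 * qform P (phi 0) w <= k * U.
    apply: le_trans (ler_wpM2l _ (le_trans qw (ler_wpM2l sigma0 phiE))) _ => //.
    by rewrite /k !mulrA.
  have := ler_wpM2l r0 h1; rewrite -/Q expr2; lra.
(* Either the present value attains [U], or for small h the gap U - q0 covers both what the present
   part can gain and the required loss h U. *)
have gap : \forall h \near 0^'+, q0 = U \/ h * (k * U + Q + U) <= U - q0.
  have [->|neq] := eqVneq q0 U; first by near=> h; left.
  near=> h; right; near: h; apply: near_right_mul_le.
  by rewrite subr_gt0 lt_neqAle neq.
near=> h.
have h0 : 0 < h by near: h; exact: nbhs_right_gt.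
have hU : h * U <= e by near: h; exact: near_right_mul_le.
have hQ : h * Q <= e by near: h; exact: near_right_mul_le.
have gaph : q0 = U \/ h * (k * U + Q + U) <= U - q0 by near: h; exact: gap.
have h1 : h <= 1 by rewrite -[h]mulr1; near: h; exact: near_right_mul_le.
apply: wsup_le => s sD; rewrite driver_extE ?(ltW h0)//.
have kq0 : 0 <= h * ((1 + k) * q0) by rewrite !mulr_ge0// ?(ltW h0)// addr_ge0.
case: ltP => hs.
  have shD : s + h \in `[- Delta, 0].
    by move: sD; rewrite !in_itv/= => /andP[s1 s2]; apply/andP; split; lra.
  have -> : expR s = expR (- h) * expR (s + h) by rewrite -expRD; congr expR; ring.
  rewrite -mulrA; apply: le_trans (ler_wpM2l (expR_ge0 _) (le_wsup phi shD)) _.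
  (* This follows from 1 + h <= exp h and (1 + h)(1 - h + h^2) = 1 + h^3; the surplus h^2 U is at
     most h e. *)
  rewrite -/U; have eh : expR (- h) <= 1 - h + h * h.
    rewrite expRN; have h1p : 0 < 1 + h by rewrite addr_gt0.
    apply: le_trans (_ : (1 + h)^-1 <= _).
      by rewrite lef_pV2 ?posrE ?expR_gt0// expR_ge1Dx.
    rewrite -(ler_pM2r h1p) mulVf ?gt_eqF//.
    have h3 : 0 <= h * h * h by rewrite !mulr_ge0 ?(ltW h0).
    lra.
  apply: le_trans (ler_wpM2r U0 eh) _.
  have := ler_wpM2l (ltW h0) hU; lra.
have r0 : 0 <= h + s by lra.
have rh : h + s <= h by move: sD; rewrite in_itv/= => /andP[_]; lra.
apply: le_trans (ler_piMl (q_ge0 _) (exp_delay_le1 sD)) _.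
apply: le_trans (lin _ r0) _.
have kU0 : 0 <= k * U by rewrite mulr_ge0.
have a1 : (h + s) * (k * U) <= h * (k * U) by rewrite ler_wpM2r.
have a2 : (h + s) ^+ 2 * Q <= h * (h * Q).
  by rewrite mulrA ler_wpM2r// expr2 ler_pM.
have a3 : h * (h * Q) <= h * e by rewrite ler_wpM2l// ltW.
case: gaph => [q0E|gaph].
  have -> : q0 = U by []. lra.
have a4 : h * (h * Q) <= h * Q by rewrite ler_piMl// mulr_ge0 ?(ltW h0).
have : 0 <= h * e by rewrite mulr_ge0// ltW.
lra.
Unshelve. all: by end_near. Qed.

End WeightedSup.

(** * Decay and uniqueness *)

Lemma continuous_exponential (R : realType) (C nu : R) :
  continuous (fun t => C * expR (- (nu * t))).
Proof.
move=> t; apply: cvgM; first exact: cvg_cst.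
apply: (@continuous_comp _ _ _ (fun t : R => - (nu * t)) expR).
  by apply: cvgN; apply: cvgM; [exact: cvg_cst|exact: cvg_id].
exact: continuous_expR.
Qed.

(** Because nu < mu, the error e can be taken as (mu - nu) z for the barrier z; one step then stays
    below the tangent z (1 - nu h), hence below the exponential. The rates may be negative, which is
    how [trajectory_unique] uses it. *)
Lemma dini_exponential (R : realType) (D : R -> R) (T mu nu C : R) :
  continuous D -> D 0 <= C -> 0 < C ->
  (forall t e, 0 <= t < T -> 0 < e ->
    \forall h \near 0^'+, D (t + h) <= D t + h * (- mu * D t + e)) ->
  nu < mu -> forall t, 0 <= t <= T -> D t <= C * expR (- (nu * t)).
Proof.
move=> cD D0 C0 step numu; apply: comparison => //.
- exact: continuous_exponential.
- by rewrite mulr0 oppr0 expR0 mulr1.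
move=> t tT Dle; set z := C * expR (- (nu * t)).
have z0 : 0 < z by rewrite mulr_gt0 ?expR_gt0.
have Dz : D t <= z by apply: Dle; move/andP: tT => [-> _] /=.
have e0 : 0 < (mu - nu) * z by rewrite mulr_gt0 ?subr_gt0.
near=> h.
have h0 : 0 < h by near: h; exact: nbhs_right_gt.
have hmu : h * mu <= 1 by near: h; exact: near_right_mul_le.
have h1 : D (t + h) <= D t + h * (- mu * D t + (mu - nu) * z).
  by near: h; exact: step.
apply: (le_trans h1).
apply: le_trans (_ : z * (1 + - (nu * h)) <= _); last first.
  rewrite (mulrDr nu) opprD expRD mulrA -/z.
  by rewrite ler_wpM2l ?(ltW z0)// expR_ge1Dx.
have : 0 <= (1 - h * mu) * (z - D t) by rewrite mulr_ge0// subr_ge0.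
lra.
Unshelve. all: by end_near. Qed.

Section Trajectories.
Context (R : realType) (Delta : R) (n : nat) (Delta_ge0 : 0 <= Delta).
Implicit Types (phi : hist Delta n) (w : 'cV[R]_n) (x y : R -> 'cV[R]_n).
Implicit Types (V W : hist Delta n -> R) (f : hist Delta n -> 'cV[R]_n).

(** Continuity on the whole line makes every segment a plain shift; [solution_trajectory] brings
    solutions to this form. *)
Definition trajectory f x (T : R) := continuous x /\
  forall t, 0 <= t < T -> right_derivative x t (f (segment Delta x t)).

Lemma hnorm_segment_le x t M : continuous x -> hnorm (segment Delta x 0) <= M ->
  (forall s, 0 <= s <= t -> enorm (x s) <= M) ->
  0 <= t -> hnorm (segment Delta x t) <= M.
Proof.
move=> cx x0M xM t0; apply: segment_hnorm_le => // u /andP[u1 u2].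
have [u0|u0] := leP 0 u; first by apply: xM; rewrite u0.
apply: le_trans x0M; rewrite -[u]add0r -(@segment_shiftE _ Delta)//.
  by apply: le_hnorm; rewrite in_itv/=; apply/andP; split; lra.
by rewrite in_itv/=; apply/andP; split; lra.
Qed.

Lemma upper_growthD V W phi w A B c : 0 < c -> upper_growth V phi w A ->
  upper_growth W phi w B ->
  upper_growth (fun phi => V phi + c * W phi) phi w (A + c * B).
Proof.
move=> c0 gV gW e e0; have e20 : 0 < e / 2 by rewrite divr_gt0.
have e2c : 0 < e / 2 / c by rewrite divr_gt0.
near=> h.
have h1 : V (driver_ext phi w h) <= V phi + h * (A + e / 2).
  by near: h; exact: gV.
have h2 : W (driver_ext phi w h) <= W phi + h * (B + e / 2 / c).
  by near: h; exact: gW.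
have h3 := ler_wpM2l (ltW c0) h2.
have h4 : c * (W phi + h * (B + e / 2 / c)) = c * W phi + h * (c * B + e / 2).
  by field; rewrite gt_eqF.
lra.
Unshelve. all: by end_near. Qed.

Lemma upper_growthW W phi w A B : A <= B -> upper_growth W phi w A ->
  upper_growth W phi w B.
Proof.
move=> AB gW e e0; near=> h.
have h0 : 0 < h by near: h; exact: nbhs_right_gt.
apply: le_trans (_ : W phi + h * (A + e) <= _).
  by near: h; exact: gW.
by rewrite lerD2l ler_pM2l// lerD2r.
Unshelve. all: by end_near. Qed.

Lemma lipschitzD V W c : 0 < c ->
  lipschitz_on_bounded (fun r : R => `|r|) V ->
  lipschitz_on_bounded (fun r : R => `|r|) W ->
  lipschitz_on_bounded (fun r : R => `|r|) (fun phi => V phi + c * W phi).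
Proof.
move=> c0 lV lW B Br; have [L HL] := lV B Br; have [M HM] := lW B Br.
exists (L + c * M) => phi psi Bphi Bpsi.
rewrite opprD addrACA -mulrBr (le_trans (ler_normD _ _))// mulrDl lerD ?HL//.
by rewrite normrM gtr0_norm// -mulrA ler_pM2l// HM.
Qed.

Lemma trajectory_dini W f x T mu : lipschitz_on_bounded (fun r : R => `|r|) W ->
  (forall phi, upper_growth W phi (f phi) (- mu * W phi)) ->
  trajectory f x T -> forall t e, 0 <= t < T -> 0 < e ->
  \forall h \near 0^'+, W (segment Delta x (t + h)) <=
    W (segment Delta x t) + h * (- mu * W (segment Delta x t) + e).
Proof.
move=> lW gW [cx dx] t e tT e0.
exact: upper_growth_segment lW cx (dx _ tT) (gW _) _ e0.
Qed.

(** The rate is halved once to leave slack in [dini_exponential], and once more by passing from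
    |x|^2 to |x|. The factor 1 + be / al dominates the square root of be / al. *)
Lemma lyapunov_decay W f x T mu al be : 0 < al -> 0 < be -> 0 < mu ->
  lipschitz_on_bounded (fun r : R => `|r|) W ->
  (forall phi, upper_growth W phi (f phi) (- mu * W phi)) ->
  (forall phi, al * enorm (phi 0) ^+ 2 <= W phi <= be * hnorm phi ^+ 2) ->
  trajectory f x T -> forall t, 0 <= t <= T ->
  enorm (x t) <= (1 + be / al) * hnorm (segment Delta x 0) * expR (- (mu / 4 * t)).
Proof.
move=> al0 be0 mu0 lW gW Wb tr t tT; have [cx _] := tr.
set k := 1 + be / al; set r := hnorm _; set ex := expR _.
have k0 : 0 < k by rewrite addr_gt0// divr_gt0.
have r0 : 0 <= r by exact: hnorm_ge0.
have ex1 : ex <= 1.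
  rewrite -expR0 ler_expR oppr_le0 mulr_ge0 ?divr_ge0 ?(ltW mu0)//.
  by move/andP: tT => [].
(* The barrier must start from a positive value, whereas r may vanish. *)
apply/ler_addgt0Pr => e e0; set r' := r + e / k.
have r'0 : 0 < r' by rewrite ltr_wpDl// divr_gt0.
have rr' : r <= r' by rewrite lerDl divr_ge0// ltW.
apply: le_trans (_ : k * r' * ex <= _); last first.
  rewrite /r' mulrDr mulrDl lerD2l mulrCA mulfV ?gt_eqF// mulr1.
  by rewrite ler_piMr// ltW.
have kr0 : 0 <= k * r' * ex by rewrite !mulr_ge0 ?expR_ge0 ?ltW.
rewrite -(@ler_pXn2r _ 2)// ?nnegrE ?enorm_ge0//.
have C0 : 0 < be * r' ^+ 2 by rewrite mulr_gt0// exprn_gt0.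
have W0 : W (segment Delta x 0) <= be * r' ^+ 2.
  have /andP[_ h] := Wb (segment Delta x 0); apply: le_trans h _.
  by rewrite ler_pM2l// ler_pXn2r ?nnegrE// ltW.
have mu2 : mu / 2 < mu by rewrite ltr_pdivrMr// ltr_pMr// ltr1n.
have cW := continuous_functional_segment Delta_ge0 lW cx.
have := dini_exponential cW W0 C0 (trajectory_dini lW gW tr) mu2 tT.
have -> : expR (- (mu / 2 * t)) = ex ^+ 2.
  by rewrite expr2 -expRD; congr expR; field.
move=> h2; have /andP[h1 _] := Wb (segment Delta x t).
rewrite segment_shiftE ?zero_in_delay// addr0 in h1.
have := le_trans h1 h2; rewrite mulrC -ler_pdivlMr// => h3.
apply: le_trans h3 _.
rewrite [leLHS](_ : _ = be / al * (r' ^+ 2 * ex ^+ 2)); last by field; rewrite gt_eqF.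
rewrite [leRHS](_ : _ = k ^+ 2 * (r' ^+ 2 * ex ^+ 2)); last by ring.
apply: ler_wpM2r; first by rewrite mulr_ge0 ?sqr_ge0.
by rewrite /k; have : 0 < be / al by [rewrite divr_gt0|]; nra.
Qed.

(** A Gronwall argument: D(u) = ||x_u - y_u|| starts at 0 and grows at rate at most L D, so it lies
    below C exp((L + 1) u) for every C > 0. *)
Lemma trajectory_unique f x y T r : lipschitz_on_bounded (@enorm R n) f ->
  trajectory f x T -> trajectory f y T ->
  segment Delta x 0 = segment Delta y 0 ->
  (forall t, 0 <= t <= T -> hnorm (segment Delta x t) <= r) ->
  (forall t, 0 <= t <= T -> hnorm (segment Delta y t) <= r) ->
  forall t, 0 <= t <= T -> x t = y t.
Proof.
move=> lf [cx dx] [cy dy] xy0 xr yr t tT.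
have [L L0 HL] := lipschitz_ball Delta_ge0 r lf.
pose z := x \- y; have cz : continuous z by move=> u; apply: cvgB; [exact: cx|exact: cy].
pose D u := hnorm (segment Delta z u).
have DE u : D u = hnorm (segment Delta x u - segment Delta y u) by rewrite /D segmentB.
have cD : continuous D.
  exact: (continuous_functional_segment Delta_ge0 (@lipschitz_hnorm R Delta n Delta_ge0) cz).
have D0 : D 0 = 0 by rewrite DE xy0 subrr hnorm0.
have D_ge0 u : 0 <= D u by exact: hnorm_ge0.
have step u e : 0 <= u < T -> 0 < e ->
    \forall h \near 0^'+, D (u + h) <= D u + h * (- - L * D u + e).
  move=> uT e0; have e20 : 0 < e / 2 by rewrite divr_gt0.
  have uT' : 0 <= u <= T by move/andP: uT => [-> /ltW ->].
  have /near_at_right0P[d1 d10 d1P] := dx _ uT _ e20.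
  have /near_at_right0P[d2 d20 d2P] := dy _ uT _ e20.
  apply/near_at_right0P; exists (Num.min d1 d2); first by rewrite lt_min d10.
  move=> h /andP[h0]; rewrite lt_min => /andP[hd1 hd2].
  have g0 : 0 <= - - L * D u + e by rewrite opprK addr_ge0 ?mulr_ge0// ltW.
  have hg0 : 0 <= h * (- - L * D u + e) by rewrite mulr_ge0// ltW.
  (* Times up to u are already counted in [D u]; only those in (u, u + h] need the equation. *)
  apply: segment_hnorm_le => // v /andP[v1 v2]; have [vu|uv] := leP v u.
    rewrite (le_trans _ (lerD (lexx (D u)) hg0))// addr0.
    rewrite -(subrKC u v) -(@segment_shiftE _ Delta)//.
      by apply: le_hnorm; rewrite in_itv/=; apply/andP; split; lra.
    by rewrite in_itv/=; apply/andP; split; lra.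
  set s := v - u; have s0 : 0 < s by rewrite subr_gt0.
  have sh : s <= h by rewrite /s; lra.
  apply: le_trans (_ : D u + s * (- - L * D u + e) <= _); last first.
    by rewrite lerD2l ler_wpM2r.
  have e1 := d1P s ltac:(by rewrite s0 (le_lt_trans sh)).
  have e2 := d2P s ltac:(by rewrite s0 (le_lt_trans sh)).
  have e3 : enorm (z u) <= D u by exact: enorm_le_segment.
  have := HL _ _ (xr _ uT') (yr _ uT'); rewrite -DE => e4.
  rewrite (_ : v = u + s); last by rewrite /s subrKC.
  set fx := f _ in e1 e4; set fy := f _ in e2 e4.
  have -> : z (u + s) = z u + (x (u + s) - x u - s *: fx)
      - (y (u + s) - y u - s *: fy) + s *: (fx - fy).
    by rewrite /z scalerBr; apply/matrixP => i j; rewrite !mxE; ring.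
  apply: le_trans (ler_enormD _ _) _.
  have e5 : enorm (s *: (fx - fy)) <= s * (L * D u).
    by rewrite enormZ gtr0_norm// ler_pM2l.
  have e6 := ler_enormD (z u + (x (u + s) - x u - s *: fx)) (- (y (u + s) - y u - s *: fy)).
  have e7 := ler_enormD (z u) (x (u + s) - x u - s *: fx).
  rewrite enormN in e6; lra.
suff Dt : D t <= 0.
  have := le_trans (enorm_le_segment Delta_ge0 t cz) Dt => /enorm_eq0/eqP.
  by rewrite subr_eq0 => /eqP.
apply/ler_addgt0Pr => e e0; rewrite add0r.
pose C := e / expR ((L + 1) * t).
have C0 : 0 < C by rewrite divr_gt0 ?expR_gt0.
have nu : - (L + 1) < - L by rewrite ltrN2 ltrDl.
have D0C : D 0 <= C by rewrite D0 ltW.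
have := dini_exponential cD D0C C0 step nu tT.
by rewrite mulNr opprK /C divfK// gt_eqF// expR_gt0.
Qed.

End Trajectories.

(** * Existence for bounded Lipschitz fields *)

Section Derivatives.
Context (R : realType) (n : nat).
Implicit Types (x : R -> 'cV[R]_n) (w : 'cV[R]_n) (t : R).

Lemma right_derivativeP x t w : right_derivative x t w <->
  h^-1 *: (x (t + h) - x t) @[h --> 0^'+] --> w.
Proof.
split=> [xw|xw e e0].
  apply/cvgrPdist_le => e e0; near=> h.
  have h0 : 0 < h by near: h; exact: nbhs_right_gt.
  rewrite distrC; apply: le_trans (ler_norm_enorm _) _.
  rewrite -[X in _ - X](scalerK (_ : h != 0)) ?gt_eqF// -scalerBr enormZ.
  rewrite gtr0_norm ?invr_gt0// mulrC ler_pdivrMr//.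
  by near: h; exact: xw.
have K0 : 0 < Num.sqrt n%:R + 1 :> R by rewrite ltr_wpDl// sqrtr_ge0.
have d0 : 0 < e / (Num.sqrt n%:R + 1) by rewrite divr_gt0.
move/cvgrPdist_le: xw => /(_ _ d0) xw; near=> h.
have h0 : 0 < h by near: h; exact: nbhs_right_gt.
have h1 : `|w - h^-1 *: (x (t + h) - x t)| <= e / (Num.sqrt n%:R + 1).
  by near: h; exact: xw.
rewrite -[x (t + h) - x t](scalerKV (_ : h != 0)) ?gt_eqF// -scalerBr enormZ.
rewrite gtr0_norm// mulrC ler_pM2r// enorm_distC.
apply: le_trans (ler_enorm_norm _) _.
apply: le_trans (ler_wpM2l (sqrtr_ge0 _) h1) _.
by rewrite mulrCA ger_pMr// ler_pdivrMr// mul1r lerDl.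
Unshelve. all: by end_near. Qed.

Lemma is_derive_right x t w : is_derive t 1 x w -> right_derivative x t w.
Proof.
move=> dx; apply/right_derivativeP.
have : h^-1 *: ((x \o shift t) (h *: 1) - x t) @[h --> 0^'] --> w.
  by rewrite -(@derive_val _ _ _ _ _ _ _ dx); exact: (@ex_derive _ _ _ _ _ _ _ dx).
move=> /cvgrPdist_le H; apply/cvgrPdist_le => e /H.
rewrite /dnbhs /at_right !near_withinE; apply: filterS => h hP h0.
have := hP; rewrite gt_eqF// => /(_ isT).
by rewrite /= [_ *: 1]mulr1 (addrC h).
Qed.

Lemma right_derivativeB x y t w v : right_derivative x t w ->
  right_derivative y t v -> right_derivative (x \- y) t (w - v).
Proof.
move=> xw yv e e0; have e20 : 0 < e / 2 by rewrite divr_gt0.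
near=> h; have h1 : enorm (x (t + h) - x t - h *: w) <= e / 2 * h.
  by near: h; exact: xw.
have h2 : enorm (y (t + h) - y t - h *: v) <= e / 2 * h.
  by near: h; exact: yv.
rewrite [X in enorm X](_ : _ = (x (t + h) - x t - h *: w) -
    (y (t + h) - y t - h *: v)); last first.
  by rewrite scalerBr; apply/matrixP => i j; rewrite !mxE; ring.
apply: le_trans (ler_enormD _ _) _; rewrite enormN; lra.
Unshelve. all: by end_near. Qed.

Lemma right_derivative_near x y t w : x t = y t ->
  (\forall h \near 0^'+, x (t + h) = y (t + h)) ->
  right_derivative x t w -> right_derivative y t w.
Proof.
move=> xyt xy xw e /xw; apply: filter_app; move: xy; apply: filterS => h xyh.
by rewrite xyt xyh.
Qed.

Lemma coord_continuous_col (g : R -> 'cV[R]_n) i :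
  continuous g -> continuous (fun t => g t i 0).
Proof.
move=> cg t; apply/cvgrPdist_le => e e0.
have /cvgrPdist_le/(_ _ e0) := cg t; apply: filterS => s.
apply: le_trans; rewrite [in leRHS]/Num.norm/= mx_normrE.
have := le_bigmax 0 (fun ij : 'I_n * 'I_1 => `|(g t - g s) ij.1 ij.2|) (i, 0).
by rewrite /= !mxE.
Qed.

Lemma antiderivative (g : R -> 'cV[R]_n) : continuous g ->
  exists G : R -> 'cV[R]_n, forall t, 0 <= t -> is_derive t 1 G (g t).
Proof.
(* Integrating from -1 makes 0 an interior point, so the derivative there is two-sided. *)
move=> cg; pose F i t := (\int[lebesgue_measure]_(s in `[(-1), t]) (g s i 0))%R.
exists (fun t => \col_i F i t) => t t0.
have tN1 : -1 < t by rewrite (lt_le_trans _ t0)// oppr_lt0.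
have FE i : derivable (F i) t 1 /\ (F i)^`()%classic t = g t i 0.
  apply: (@continuous_FTC1_closed _ (fun s => g s i 0) (-1) t (t + 1)) => //.
  - by rewrite ltrDl.
  - apply: continuous_compact_integrable; first exact: segment_compact.
    by apply: continuous_subspaceT; exact: coord_continuous_col.
  - exact: coord_continuous_col.
have dG : derivable (fun t => \col_i F i t) t 1.
  apply/derivable_mxP => i j; have [+ _] := FE i.
  by apply: near_eq_derivable; near=> s; rewrite mxE.
apply: DeriveDef => //; rewrite derive_mx//; apply/matrixP => i j.
rewrite mxE ord1 -(FE i).2 derive1E; apply: near_eq_derive.
by near=> s; rewrite mxE.
Unshelve. all: by end_near. Qed.

End Derivatives.

Section GlobalLipschitz.
Context (R : realType) (Delta : R) (n : nat) (Delta_ge0 : 0 <= Delta).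
Implicit Types (phi psi : hist Delta n) (x y g : R -> 'cV[R]_n) (t : R).

Lemma hist_extension phi : exists2 x, continuous x &
  {in `[- Delta, 0], x =1 phi} /\ forall t, 0 <= t -> x t = phi 0.
Proof.
pose cl (t : R) := Num.min (Num.max t (- Delta)) 0.
have ccl : continuous cl.
  move=> t; apply: (@continuous_min R R (fun t => Num.max t (- Delta)) (cst 0)).
    by apply: (@continuous_max R R id (cst (- Delta))); [exact: cvg_id|exact: cvg_cst].
  exact: cst_continuous.
have clD t : `[- Delta, 0]%classic (cl t).
  by rewrite /= in_itv/= /cl le_min ge_min lexx orbT andbT le_max lexx orbT/= oppr_le0.
exists (phi \o cl); last split.
- apply/continuous_subspace_setT.
  by apply: (within_continuous_comp_in ccl _ (@hist_continuous _ _ _ phi)) => t _.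
- move=> t; rewrite in_itv/= => /andP[t1 t2] /=; congr (phi _).
  by rewrite /cl max_l// min_l.
- move=> t t0 /=; congr (phi _).
  by rewrite /cl max_l ?min_r// (le_trans _ t0)// oppr_le0.
Qed.

(** One Picard step: [p] is constant after 0 and the primitive of [g] is frozen before 0, so their
    sum keeps the history and has derivative [g] afterwards. *)
Lemma primitive_extension p g : continuous p -> (forall t, 0 <= t -> p t = p 0) ->
  continuous g -> exists x, [/\ continuous x,
  forall t, t <= 0 -> x t = p t,
  forall t, 0 <= t -> right_derivative x t (g t) &
  forall t, 0 < t -> is_derive t 1 x (g t)].
Proof.
move=> cp pc cg; have [G dG] := antiderivative cg.
pose x t := p t + (G (Num.max t 0) - G 0).
have xE t : 0 <= t -> x t = (p 0 - G 0) + G t.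
  by move=> t0; rewrite /x (pc t)// max_l// addrA addrAC.
have cx : continuous x.
  move=> t; apply: cvgD; first exact: cp.
  apply: cvgB; last exact: cvg_cst.
  apply: (@continuous_comp _ _ _ (fun t : R => Num.max t 0) G).
    by apply: (@continuous_max R R id (cst 0)); [exact: cvg_id|exact: cvg_cst].
  apply: differentiable_continuous; apply/derivable1_diffP.
  by have := dG (Num.max t 0); rewrite le_max lexx orbT => /(_ isT)[].
have dG' t : 0 <= t -> is_derive t 1 (fun t => (p 0 - G 0) + G t) (g t).
  move=> t0; have dGt := dG _ t0.
  by rewrite -[g t]add0r; apply: is_deriveD; exact: is_derive_cst.
exists x; split=> //.
- by move=> t t0; rewrite /x max_r// subrr addr0.
- move=> t t0; apply: right_derivative_near (is_derive_right (dG' _ t0)).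
    by rewrite xE.
  near=> h; rewrite xE// addr_ge0//; near: h; exact: nbhs_right_ge.
- move=> t t0; apply: near_eq_is_derive (dG' _ (ltW t0)).
  near=> s; rewrite xE//; near: s; exact: lt_le_nbhsr.
Unshelve. all: by end_near. Qed.

(** The weight exp(2 L t) grows so fast that integrating L b exp(2 L s) yields at most half of b
    exp(2 L t): a contraction by 1/2 on the whole half-line. *)
Lemma primitive_dist x y g g' (L b : R) : continuous x -> continuous y ->
  x 0 = y 0 ->
  (forall t, 0 <= t -> right_derivative x t (g t)) ->
  (forall t, 0 <= t -> right_derivative y t (g' t)) ->
  (forall t, 0 <= t -> enorm (g t - g' t) <= L * b * expR (2 * L * t)) ->
  0 <= b ->
  forall t, 0 <= t -> enorm (x t - y t) <= b / 2 * expR (2 * L * t).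
Proof.
move=> cx cy xy0 dx dy gg' b0 t t0.
have cz : continuous (x \- y) by move=> u; apply: cvgB; [exact: cx|exact: cy].
have cE : continuous (fun s => b / 2 * expR (2 * L * s)).
  rewrite [X in continuous X](_ : _ = fun s => b / 2 * expR (- (- (2 * L) * s))).
    exact: continuous_exponential.
  by apply/funext => s; rewrite mulNr opprK.
(* A term d s added to the barrier pays for the o(h) remainders; at time t it is at most e. *)
apply/ler_addgt0Pr => e e0; pose d := e / (t + 1).
have d0 : 0 < d by rewrite divr_gt0// ltr_wpDl.
apply: le_trans (_ : b / 2 * expR (2 * L * t) + d * t <= _); last first.
  rewrite lerD2l /d mulrAC -mulrA ger_pMr// ler_pdivrMr ?ltr_wpDl//.
  by rewrite mul1r lerDl.
pose z s := b / 2 * expR (2 * L * s) + d * s.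
apply: (@comparison _ (fun s => enorm ((x \- y) s)) z t).
- move=> s; apply: (@continuous_comp _ _ _ (x \- y) (@enorm R n)); first exact: cz.
  exact: continuous_enorm.
- move=> s; apply: cvgD; last by apply: cvgM; [exact: cvg_cst|exact: cvg_id].
  exact: cE.
- by rewrite /z /= xy0 subrr enorm0 !mulr0 expR0 mulr1 addr0 divr_ge0.
- move=> s /andP[s0 _] Dle; have zs : enorm ((x \- y) s) <= z s by apply: Dle; rewrite s0/=.
  have := right_derivativeB (dx _ s0) (dy _ s0) d0.
  apply: filter_app; near=> h => hd.
  have h0 : 0 < h by near: h; exact: nbhs_right_gt.
  rewrite -(subrK ((x \- y) s) ((x \- y) (s + h))) -(subrK (h *: (g s - g' s)) (_ - _)).
  apply: le_trans (ler_enormD _ _) _.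
  have h1 := ler_enormD ((x \- y) (s + h) - (x \- y) s - h *: (g s - g' s)) (h *: (g s - g' s)).
  have h2 : enorm (h *: (g s - g' s)) <= h * (L * b * expR (2 * L * s)).
    by rewrite enormZ gtr0_norm// ler_pM2l// gg'.
  have h3 : b / 2 * expR (2 * L * s) * (1 + 2 * L * h) <= b / 2 * expR (2 * L * (s + h)).
    rewrite (mulrDr (2 * L)) expRD mulrA ler_wpM2l ?expR_ge1Dx//.
    by rewrite mulr_ge0 ?expR_ge0// divr_ge0.
  by move: zs; rewrite /z; lra.
- by rewrite t0 lexx.
Unshelve. all: by end_near. Qed.

Lemma exists_half_pow_le (c e : R) : 0 <= c -> 0 < e -> exists k, c / 2 ^+ k <= e.
Proof.
move=> c0 e0; exists (Num.bound (c / e)).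
rewrite ler_pdivrMr ?exprn_gt0// mulrC -ler_pdivrMr//.
by apply/ltW/upper_nthrootP.
Qed.

(** Picard iteration in the weighted distance converges for all times at once, so no local solutions
    have to be glued. *)
Lemma global_solution (f : hist Delta n -> 'cV[R]_n) phi (L M : R) : 0 < L ->
  (forall phi psi, enorm (f phi - f psi) <= L * hnorm (phi - psi)) ->
  (forall phi, enorm (f phi) <= M) -> exists x, [/\ continuous x,
  {in `[- Delta, 0], x =1 phi},
  forall t, 0 <= t -> right_derivative x t (f (segment Delta x t)) &
  forall t, 0 < t -> is_derive t 1 x (f (segment Delta x t))].
Proof.
move=> L0 fL fM; have [p cp [pphi p0]] := hist_extension phi.
have pc t : 0 <= t -> p t = p 0 by move=> t0; rewrite !p0.
have lf : lipschitz_on_bounded (@enorm R n) f.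
  by move=> B _; exists L => psi1 psi2 _ _; exact: fL.
have cf x : continuous x -> continuous (fun t => f (segment Delta x t)).
  exact: continuous_field_segment.
(* [T] is the Picard operator; its values at discontinuous functions do not matter. *)
have /choice[T TP] (x : R -> 'cV[R]_n) : exists y, continuous x -> [/\ continuous y,
  forall t, t <= 0 -> y t = p t,
  forall t, 0 <= t -> right_derivative y t (f (segment Delta x t)) &
  forall t, 0 < t -> is_derive t 1 y (f (segment Delta x t))].
  have [cx|] := pselect (continuous x); last by exists x.
  by have [y yP] := primitive_extension cp pc (cf _ cx); exists y.
(* Being nondecreasing, the weight at t bounds the weight over the whole history of t. *)
pose w t := expR (2 * L * Num.max t 0).
have w_ge0 t : 0 <= w t by exact: expR_ge0.
have w_mono s t : s <= t -> w s <= w t.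
  move=> st; rewrite ler_expR ler_wpM2l ?mulr_ge0 ?(ltW L0)//.
  by rewrite ge_max !le_max st lexx orbT.
have T_dist x y b : continuous x -> continuous y -> 0 <= b ->
    (forall t, 0 <= t -> enorm (f (segment Delta x t) - f (segment Delta y t)) <=
      L * b * w t) ->
    forall t, enorm (T x t - T y t) <= b / 2 * w t.
  move=> cx cy b0 xy t; have [cTx Tx0 dTx _] := TP _ cx.
  have [cTy Ty0 dTy _] := TP _ cy.
  have [t0|/ltW t0] := leP 0 t; last first.
    by rewrite Tx0// Ty0// subrr enorm0 mulr_ge0// divr_ge0.
  rewrite /w max_l//; apply: (primitive_dist cTx cTy _ dTx dTy) => //.
    by rewrite Tx0// Ty0.
  by move=> s s0; have := xy s s0; rewrite /w max_l.
have T_contract x y b : continuous x -> continuous y -> 0 <= b ->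
    (forall t, enorm (x t - y t) <= b * w t) ->
    forall t, enorm (T x t - T y t) <= b / 2 * w t.
  move=> cx cy b0 xy; apply: T_dist => // t t0.
  apply: le_trans (fL _ _) _; rewrite -mulrA ler_pM2l//.
  apply: (hnorm_le Delta_ge0) => s sD; rewrite histBE !segment_shiftE//.
  apply: le_trans (xy _) _; rewrite ler_wpM2l// w_mono// gerDl.
  by move: sD; rewrite in_itv/= => /andP[].
(* Starting at an image of [T], the first two iterates have derivatives bounded by [M] after 0,
   hence at most 2 M = L b apart. *)
pose u k := iter k T (T (cst 0)).
have cu k : continuous (u k).
  elim: k => [|k IHk].
    by have [] := TP (cst 0); first by move=> ?; exact: cvg_cst.
  by have [] := TP _ IHk.
pose b := 2 * M / L.
have M0 : 0 <= M by exact: le_trans (enorm_ge0 _) (fM 0).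
have b0 : 0 <= b by rewrite !mulr_ge0// invr_ge0 ltW.
have u_succ k t : enorm (u k.+1 t - u k t) <= b / 2 ^+ k * w t.
  elim: k t => [|k IHk] t.
    apply: le_trans (_ : b / 2 * w t <= _); last first.
      rewrite expr0 divr1 ler_wpM2r// ler_pdivrMr// ler_peMr//.
      by rewrite ler1n.
    apply: (T_dist (u 0) (cst 0)) => //.
      by move=> ?; exact: cvg_cst.
    move=> s s0; apply: le_trans (ler_enormD _ _) _; rewrite enormN.
    apply: le_trans (lerD (fM _) (fM _)) _.
    have -> : L * b = 2 * M by rewrite /b mulrC divfK// gt_eqF.
    have w1 : 1 <= w s.
      by rewrite -expR0 ler_expR mulr_ge0 ?mulr_ge0 ?(ltW L0)// le_max lexx orbT.
    have : 0 <= M * (w s - 1) by rewrite mulr_ge0// subr_ge0.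
    lra.
  rewrite exprSr invfM mulrA.
  apply: (T_contract (u k.+1) (u k) _ (cu k.+1) (cu k) _ IHk).
  by rewrite divr_ge0// exprn_ge0.
have c_ge0 k : 0 <= 2 * b / 2 ^+ k.
  by apply: divr_ge0; [exact: mulr_ge0|exact: exprn_ge0].
have u_add k m t : enorm (u (k + m)%N t - u k t) <=
    (2 * b / 2 ^+ k - 2 * b / 2 ^+ (k + m)) * w t.
  elim: m => [|m IHm]; first by rewrite addn0 !subrr enorm0 mul0r.
  rewrite addnS -(subrK (u (k + m)%N t) (u _.+1 t)) -addrA.
  apply: le_trans (ler_enormD _ _) _.
  apply: le_trans (lerD (u_succ _ _) IHm) _.
  rewrite -mulrDl ler_wpM2r// exprSr invfM.
  by set q := _^-1; set q' := _^-1; lra.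
have u_dist k m t : (k <= m)%N -> enorm (u m t - u k t) <= 2 * b / 2 ^+ k * w t.
  move=> km; rewrite -(subnKC km); apply: le_trans (u_add _ _ _) _.
  by rewrite ler_wpM2r// gerBl c_ge0.
have small t e : 0 < e -> exists k, 2 * b / 2 ^+ k * w t <= e.
  move=> e0; have [||k kP] := @exists_half_pow_le (2 * b * w t) e => //.
    by apply: mulr_ge0; [exact: mulr_ge0|exact: w_ge0].
  by exists k; rewrite mulrAC.
have u_cvg t : cvg (u k t @[k --> \oo]).
  apply: cauchy_cvg; apply: cauchy_exP => e e0.
  have e20 : 0 < e / 2 by rewrite divr_gt0.
  have [k kP] := small t _ e20; exists (u k t).
  exists k => // m /= km; rewrite -ball_normE /=.
  apply: le_lt_trans (ler_norm_enorm _) _; rewrite enorm_distC.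
  apply: le_lt_trans (u_dist _ _ _ km) _; apply: le_lt_trans kP _.
  by rewrite ltr_pdivrMr// ltr_pMr// ltr1n.
pose x t := lim (u k t @[k --> \oo]).
have x_dist k t : enorm (x t - u k t) <= 2 * b / 2 ^+ k * w t.
  apply/ler_addgt0Pr => e e0.
  have : enorm (x t - u m t) @[m --> \oo] --> enorm (x t - x t).
    apply: (@cvg_comp _ _ _ (fun m => x t - u m t) (@enorm R n) _ (nbhs (x t - x t))).
      by apply: cvgB; [exact: cvg_cst|exact: u_cvg].
    exact: continuous_enorm.
  rewrite subrr enorm0 => /cvgrPdist_le/(_ _ e0)[N _ NP].
  have := NP (maxn N k) (leq_maxl _ _); rewrite /= sub0r normrN ger0_norm ?enorm_ge0// => h.
  have := ler_enormD (x t - u (maxn N k) t) (u (maxn N k) t - u k t).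
  rewrite addrA subrK; have := u_dist _ _ t (leq_maxr N k); lra.
have cx : continuous x.
  move=> t; apply/cvgrPdist_le => e e0; have e30 : 0 < e / 3 by rewrite divr_gt0.
  have [k kP] := small (t + 1) _ e30.
  have /cvgrPdist_le/(_ _ e30) ut := cu k t.
  have hx r : r <= t + 1 -> `|x r - u k r| <= e / 3.
    move=> rt; apply: le_trans (ler_norm_enorm _) _.
    apply: le_trans (x_dist k r) (le_trans _ kP).
    by rewrite ler_wpM2l ?w_mono.
  near=> s.
  have h1 : `|u k t - u k s| <= e / 3 by near: s; exact: ut.
  have h2 : `|x t - u k t| <= e / 3 by apply: hx; rewrite lerDl.
  have h3 : `|x s - u k s| <= e / 3.
    by apply: hx; near: s; apply: lt_le_nbhsl; rewrite ltrDl.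
  rewrite (_ : x t - x s = (x t - u k t) + (u k t - u k s) - (x s - u k s)); last first.
    by apply/matrixP => i j; rewrite !mxE; ring.
  apply: le_trans (ler_normB _ _) _.
  have := ler_normD (x t - u k t) (u k t - u k s); lra.
have Txx : T x = x.
  apply/funext => t; apply/eqP; rewrite -subr_eq0; apply/eqP/enorm_eq0.
  apply/ler_addgt0Pr => e e0; rewrite add0r.
  have [k kP] := small t _ e0; apply: le_trans kP.
  rewrite -(subrK (u k.+1 t) (T x t)) -addrA.
  apply: le_trans (ler_enormD _ _) _.
  have h1 := T_contract x (u k) _ cx (cu k) (c_ge0 k) (x_dist k) t.
  have h2 := x_dist k.+1 t; rewrite enorm_distC in h2.
  apply: le_trans (lerD h1 h2) _.
  by rewrite exprSr invfM -mulrDl ler_wpM2r//; set q := _^-1; lra.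
have [_ xp dx dx'] := TP _ cx; rewrite Txx in xp dx dx'.
exists x; split=> // t tD; rewrite xp ?pphi//.
by move: tD; rewrite in_itv/= => /andP[].
Unshelve. all: by end_near. Qed.

End GlobalLipschitz.

(** * Exponential stability *)

Section Solutions.
Context (R : realType) (Delta : R) (n : nat) (Delta_ge0 : 0 <= Delta).
Implicit Types (phi psi : hist Delta n) (x y : R -> 'cV[R]_n) (t : R).
Implicit Types (f : hist Delta n -> 'cV[R]_n).

(* Composition with the radial retraction onto the ball of radius [B], which is
   2-Lipschitz. *)
Lemma truncation f B : 0 < B -> lipschitz_on_bounded (@enorm R n) f ->
  exists g L M, [/\ 0 < L,
    forall phi psi, enorm (g phi - g psi) <= L * hnorm (phi - psi),
    forall phi, enorm (g phi) <= M &
    forall phi, hnorm phi <= B -> g phi = f phi].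
Proof.
move=> B0 lf; have [L L0 HL] := lipschitz_ball Delta_ge0 B lf.
pose m phi := Num.max B (hnorm phi).
pose rho phi := (B / m phi) *: phi.
have m0 phi : 0 < m phi by rewrite lt_max B0.
have Bm phi : B <= m phi by rewrite le_max lexx.
have hm phi : hnorm phi <= m phi by rewrite le_max lexx orbT.
have Bm0 phi : 0 <= B / m phi by rewrite divr_ge0// ltW.
have Bm1 phi : B / m phi <= 1 by rewrite ler_pdivrMr// mul1r.
have h0 phi : 0 <= hnorm phi by exact: hnorm_ge0.
have rhoB phi : hnorm (rho phi) <= B.
  apply: le_trans (hnormZ_le Delta_ge0 _ _) _; rewrite ger0_norm//.
  by rewrite mulrAC ler_pdivrMr// ler_pM2l.
have dm phi psi : `|m psi - m phi| <= hnorm (phi - psi).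
  have := ler_dist_hnorm Delta_ge0 psi phi; rewrite hnorm_distC//.
  rewrite !ler_norml => /andP[d1 d2]; have d0 := h0 (phi - psi).
  rewrite /m; case: (leP B (hnorm psi)); case: (leP B (hnorm phi)) => *.
  - by apply/andP; split; lra.
  - by apply/andP; split; lra.
  - by apply/andP; split; lra.
  - by apply/andP; split; lra.
have rho_lip phi psi : hnorm (rho phi - rho psi) <= 2 * hnorm (phi - psi).
  (* The first term has a factor at most 1; the second is bounded because [m] is 1-Lipschitz and
     ||psi|| <= m psi. Together they give 2. *)
  have -> : rho phi - rho psi =
      (B / m phi) *: (phi - psi) + (B / m phi - B / m psi) *: psi.
    by rewrite scalerBr scalerBl addrA subrK.
  apply: le_trans (ler_hnormD Delta_ge0 _ _) _; rewrite mulr2n mulrDl mul1r.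
  apply: lerD; apply: le_trans (hnormZ_le Delta_ge0 _ _) _.
    by rewrite ger0_norm// ler_piMl.
  have -> : B / m phi - B / m psi = (B / m phi) * ((m psi - m phi) / m psi).
    by field; rewrite !gt_eqF.
  have q1 : `|(m psi - m phi) / m psi| * hnorm psi <= hnorm (phi - psi).
    apply: le_trans (dm phi psi).
    rewrite normrM (gtr0_norm (_ : 0 < (m psi)^-1)) ?invr_gt0// -mulrA ler_piMr//.
    by rewrite mulrC ler_pdivrMr// mul1r.
  rewrite normrM ger0_norm// -(mulrA (B / m phi)); apply: le_trans q1.
  by rewrite ler_piMl// mulr_ge0.
exists (f \o rho), (L * 2), (enorm (f 0) + L * B); split.
- by rewrite mulr_gt0.
- move=> phi psi /=; apply: le_trans (HL _ _ (rhoB _) (rhoB _)) _.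
  by rewrite -mulrA ler_pM2l.
- move=> phi /=; apply: le_trans (ler_enormB _ (f 0)) _; rewrite lerD2l.
  have B0' : hnorm (0 : hist Delta n) <= B by rewrite hnorm0// ltW.
  apply: le_trans (HL _ _ (rhoB phi) B0') _.
  by rewrite subr0 ler_pM2l.
- move=> phi phiB /=; congr f; rewrite /rho /m max_l// divff ?scale1r//.
  by rewrite gt_eqF.
Qed.

(** Clamping time to [-Delta, T1] extends the solution continuously to the line, and changes no
    right derivative on [0, T1). *)
Lemma solution_trajectory f (x0 : hist Delta n) (T : \bar R) x T1 :
  is_solution f x0 T x -> 0 < T1 -> (T1%:E < T)%E ->
  exists2 y, trajectory (Delta := Delta) f y T1 &
    forall t, - Delta <= t <= T1 -> y t = x t.
Proof.
move=> [T0 cx x_init dx0 dx] T10 T1T.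
pose cl (t : R) := Num.min (Num.max t (- Delta)) T1.
have ND : - Delta <= 0 by rewrite oppr_le0.
have ccl : continuous cl.
  move=> t; apply: (@continuous_min R R (fun t => Num.max t (- Delta)) (cst T1)).
    by apply: (@continuous_max R R id (cst (- Delta))); [exact: cvg_id|exact: cvg_cst].
  exact: cst_continuous.
have yx t : - Delta <= t <= T1 -> (x \o cl) t = x t.
  by move=> /andP[t1 t2]; rewrite /= /cl max_l// min_l.
exists (x \o cl) => //; split.
  apply/continuous_subspace_setT.
  apply: (within_continuous_comp_in ccl _ cx) => t _; split.
    by rewrite /cl le_min le_max lexx orbT/= (le_trans ND (ltW T10)).
  have clT1 : ((cl t)%:E <= T1%:E)%E by rewrite lee_fin /cl ge_min lexx orbT.
  exact: le_lt_trans clT1 T1T.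
move=> t /andP[t0 tT1].
have tD : - Delta <= t by exact: le_trans t0.
have -> : segment Delta (x \o cl) t = segment Delta x t.
  apply: hist_of_eq => s; rewrite in_itv/= => /andP[s1 s2].
  by apply: yx; apply/andP; split; lra.
apply: (@right_derivative_near _ _ x); first by rewrite yx// tD ltW.
  have tT1' : 0 < T1 - t by rewrite subr_gt0.
  near=> h; rewrite yx//; apply/andP; split.
    have h0 : 0 < h by near: h; exact: nbhs_right_gt.
    by rewrite (le_trans tD)// lerDl ltW.
  by rewrite addrC -lerBrDr; near: h; exact: nbhs_right_le.
move: t0; rewrite le_eqVlt => /predU1P[t0|t0]; last first.
  apply: is_derive_right; apply: dx => //.
  have tT1E : (t%:E < T1%:E)%E by rewrite lte_fin.
  exact: lt_trans tT1E T1T.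
rewrite -t0; apply/right_derivativeP.
by under eq_fun do rewrite add0r.
Unshelve. all: by end_near. Qed.

Lemma initial_segment (x0 : hist Delta n) x : continuous x ->
  {in `[- Delta, 0], x =1 x0} -> segment Delta x 0 = x0.
Proof. by move=> cx xx0; apply: histP => s sD; rewrite segment_shiftE// add0r xx0. Qed.

(** The estimate is assumed for every finite-time trajectory, so it confines solutions to a ball of
    radius K fixed in advance; 1 <= k puts the initial history in it. *)
Lemma GES_of_estimate f k eta : 1 <= k -> 0 < eta ->
  lipschitz_on_bounded (@enorm R n) f ->
  (forall x T, trajectory f x T -> forall t, 0 <= t <= T ->
    enorm (x t) <= k * hnorm (segment Delta x 0) * expR (- (eta * t))) ->
  GES f.
Proof.
move=> k1 eta0 lf est; have k0 : 0 < k by exact: lt_le_trans k1.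
exists k, eta; split=> // x0.
set K := k * hnorm x0.
have x0_ge0 : 0 <= hnorm x0 by exact: hnorm_ge0.
have K0 : 0 <= K by rewrite mulr_ge0// ltW.
have x0K : hnorm x0 <= K by exact: ler_peMl.
have exp_le1 t : 0 <= t -> expR (- (eta * t)) <= 1.
  by move=> t0; rewrite -expR0 ler_expR oppr_le0 mulr_ge0// ltW.
have B0 : 0 < K + 1 by rewrite ltr_wpDl.
have [g [L [M [L0 gL gM gf]]]] := truncation B0 lf.
have [X [cX X_init dX dX']] := global_solution Delta_ge0 x0 L0 gL gM.
have X0 : segment Delta X 0 = x0 by exact: initial_segment.
have traj T : (forall s, 0 <= s < T -> enorm (X s) <= K + 1) -> trajectory f X T.
  move=> XB; split=> // t /andP[t0 tT]; rewrite -gf; first exact: dX.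
  apply: hnorm_segment_le => //; first by rewrite X0 (le_trans x0K)// lerDl.
  by move=> s /andP[s0 st]; apply: XB; rewrite s0 (le_lt_trans st).
(* Bootstrap: if |X| <= K up to s, then |X| < K + 1 slightly longer. There the truncated and
   original fields agree, so the estimate applies and gives K again. *)
have XK t : 0 <= t -> enorm (X t) <= K.
  move=> t0; apply: (@comparison _ (fun t => enorm (X t)) (cst K) t).
  - move=> s; apply: (@continuous_comp _ _ _ X (@enorm R n)); first exact: cX.
    exact: continuous_enorm.
  - by move=> s; exact: cvg_cst.
  - by rewrite /= (le_trans _ x0K)// -X0 enorm_le_segment.
  - move=> s /andP[s0 _] /= sK.
    have cE : enorm (X u) @[u --> s] --> enorm (X s).
      apply: (@continuous_comp _ _ _ X (@enorm R n)); first exact: cX.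
      exact: continuous_enorm.
    have Xs : enorm (X s) < K + 1 by rewrite ltr_pwDr// sK// s0/=.
    have /near_at_right0P[d d0 dP] : \forall h \near 0^'+, enorm (X (s + h)) < K + 1.
      exact: (near_right_shift (P := fun u => enorm (X u) < K + 1) (cvgr_lt _ cE _ Xs)).
    apply/near_at_right0P; exists d => // h.
    move=> /andP[h0 hd].
    have sh0 : 0 <= s + h by rewrite addr_ge0// ltW.
    have tr : trajectory f X (s + h).
      apply: traj => r /andP[r0 rsh]; have [rs|sr] := leP r s.
        by rewrite (le_trans (sK _ _)) ?lerDl// r0.
      rewrite -(subrKC s r); apply/ltW/dP; rewrite subr_gt0 sr/=.
      by apply: lt_trans hd; lra.
    have := est _ _ tr (s + h); rewrite sh0 lexx X0 => /(_ isT) h1.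
    by apply: (le_trans h1); rewrite ler_piMr// exp_le1.
  - by rewrite t0 lexx.
have trX T : trajectory f X T.
  by apply: traj => s /andP[s0 _]; rewrite (le_trans (XK _ s0))// lerDl.
have gX t : 0 <= t -> g (segment Delta X t) = f (segment Delta X t).
  move=> t0; apply: gf; apply: hnorm_segment_le => //.
    by rewrite X0 (le_trans x0K)// lerDl.
  by move=> s /andP[s0 _]; rewrite (le_trans (XK _ s0))// lerDl.
have solX : is_solution f x0 +oo X.
  split=> //.
  - exact: continuous_subspaceT.
  - have /right_derivativeP := dX 0 (lexx 0); rewrite gX//.
    by under eq_fun do rewrite add0r.
  - by move=> t t0 _; rewrite -gX ?ltW//; exact: dX'.
have unique T x : is_solution f x0 T x ->
    forall t, - Delta <= t -> (t%:E < T)%E -> X t = x t.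
  move=> solx t tD tT; have [_ _ x_init _ _] := solx.
  have [t0|t0] := leP t 0.
    by rewrite X_init ?x_init// in_itv/= tD.
  have [y try yx] := solution_trajectory solx t0 tT; have [cy _] := try.
  rewrite -yx ?tD ?lexx//.
  have y0 : segment Delta y 0 = x0.
    apply: initial_segment => // s sD; rewrite yx ?x_init//.
    by move: sD; rewrite in_itv/= => /andP[-> s0]; rewrite (le_trans s0)// ltW.
  have tt : 0 <= t <= t by rewrite lexx ltW.
  apply: (trajectory_unique Delta_ge0 (r := K) lf (trX t) try _ _ _ tt).
  - by rewrite X0 y0.
  - move=> s /andP[s0 _]; apply: hnorm_segment_le; rewrite ?X0//.
    by move=> r /andP[r0 _]; exact: XK.
  - move=> s /andP[s0 st]; apply: hnorm_segment_le; rewrite ?y0//.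
    move=> r /andP[r0 rs]; have := est _ _ try r; rewrite r0 (le_trans rs st).
    rewrite y0 => /(_ isT) h1; apply: le_trans h1 _.
    by rewrite ler_piMr// exp_le1.
split.
  exists +oo%E, X; split=> // T' y _; rewrite leye_eq => /eqP -> //.
(* [X] is a global solution extending [x], so maximality forces T = +oo. *)
move=> T x [solx maxx].
have Toy : T = +oo%E.
  by apply/esym/(maxx _ _ solX); [exact: leey|exact: unique solx].
split=> // t t0; rewrite -(unique _ _ solx) ?Toy ?ltry//; last first.
  by rewrite (le_trans _ t0)// oppr_le0.
by have := est _ _ (trX t) t; rewrite t0 lexx X0; exact.
Qed.

End Solutions.

Unset Implicit Arguments.
Local Close Scope classical_set_scope.

Theorem corollary1 (R : realType) (Delta : R) (n : nat)
    (P : 'M[R]_n) (abar a sigma : R) :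
  0 <= Delta -> (1 <= n)%N ->
  0 < abar -> 0 < a -> symposdef P -> 0 < sigma ->
  exists cbar : R, 0 < cbar /\
    forall (f0 : hist Delta n -> 'cV[R]_n) (V : hist Delta n -> R) (c : R),
      lipschitz_on_bounded (@enorm R n) f0 ->
      f0 0 = 0 ->
      lipschitz_on_bounded (fun r : R => `|r|) V ->
      (forall phi : hist Delta n, 0 <= V phi <= abar * hnorm phi ^+ 2) ->
      (forall phi : hist Delta n, (driver_deriv V phi (f0 phi)
        <= (- a * enorm (phi 0%R) ^+ 2 + c * hnorm phi ^+ 2)%:E)%E) ->
      (forall phi : hist Delta n, qform P (phi 0%R) (f0 phi) <= sigma * hnorm phi ^+ 2) ->
      0 <= c < cbar ->
      GES f0.
Proof.
move=> Delta0 _ abar0 a0 Ppos sigma0.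
have [C C0 HC] := symposdef_coercive Ppos.
pose E := C * expR Delta; have E0 : 0 < E by rewrite mulr_gt0// expR_gt0.
pose K := 1 + 2 * sigma * E.
have K0 : 0 < K by apply: addr_gt0 => //; apply: mulr_gt0 => //; exact: mulr_gt0.
have S0 : 0 < mxsum P := mxsum_gt0 P.
(* Since q(v) <= mxsum P |v|^2, this gives e K q(phi(0)) <= a |phi(0)|^2. *)
pose e := a / (K * mxsum P); have e0 : 0 < e by rewrite divr_gt0// mulr_gt0.
exists (e / E); split=> [|f0 V c lf _ lV Vb dV qf /andP[c0 ce]].
  by rewrite divr_gt0.
have {}ce : 0 < e - c * E by rewrite subr_gt0 -ltr_pdivlMr//.
pose W (phi : hist Delta n) := V phi + e * wsup P phi.
have hE (phi : hist Delta n) : hnorm phi ^+ 2 <= E * wsup P phi by exact: hnorm_le_wsup.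
have U0 (phi : hist Delta n) : 0 <= wsup P phi by exact: wsup_ge0.
(* W <= D U, so the leftover - (e - c E) U is at most - mu W. *)
pose D := abar * E + e; have D0 : 0 < D by rewrite addr_gt0// mulr_gt0.
pose mu := (e - c * E) / D; have mu0 : 0 < mu by rewrite divr_gt0.
have lW : lipschitz_on_bounded (fun r : R => `|r|) W.
  by apply: lipschitzD => //; exact: lipschitz_wsup.
have gW (phi : hist Delta n) : upper_growth W phi (f0 phi) (- mu * W phi).
  have gU := upper_growth_wsup Delta0 Ppos (ltW sigma0) (hE phi) (ltW E0) (qf phi).
  apply: upper_growthW (upper_growthD e0 (upper_growth_driver_deriv (dV phi)) gU).
  rewrite -/K /W; set u := wsup P phi; set q := qform P _ _.
  set v := V phi; set p := enorm _ ^+ 2; set N := hnorm phi ^+ 2.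
  have q_le : q <= mxsum P * p.
    by rewrite /p expr2; apply: le_trans (ler_norm _) (ler_qform _ _ _).
  have eKq : e * (K * q) <= a * p.
    apply: le_trans (_ : e * (K * (mxsum P * p)) <= _).
      by rewrite !ler_pM2l.
    by rewrite le_eqVlt; apply/orP; left; apply/eqP; rewrite /e; field; rewrite !gt_eqF.
  have cN : c * N <= c * (E * u) by rewrite ler_wpM2l// hE.
  have /andP[_ vN] := Vb phi.
  have WD : v + e * u <= D * u.
    rewrite /D mulrDl lerD2r -mulrA; apply: le_trans vN _.
    by rewrite ler_pM2l// hE.
  have muW : mu * (v + e * u) <= (e - c * E) * u.
    apply: le_trans (ler_wpM2l (ltW mu0) WD) _.
    by rewrite /mu mulrA divfK// gt_eqF.
  lra.
have Wb (phi : hist Delta n) : e / C * enorm (phi 0) ^+ 2 <= W phi <=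
    (abar + e * mxsum P) * hnorm phi ^+ 2.
  have /andP[V0 VN] := Vb phi; apply/andP; split; rewrite /W.
    rewrite ler_wpDl// -mulrA ler_pM2l// mulrC ler_pdivrMr// mulrC.
    apply: le_trans (HC _) _; rewrite ler_pM2l//.
    exact: qform_le_wsup.
  by rewrite mulrDl lerD// -mulrA ler_pM2l// wsup_le_hnorm.
have be0 : 0 < abar + e * mxsum P by rewrite addr_gt0// mulr_gt0.
have al0 : 0 < e / C by rewrite divr_gt0.
apply: (@GES_of_estimate _ _ _ Delta0 f0 (1 + (abar + e * mxsum P) / (e / C)) (mu / 4)) => //.
- by rewrite lerDl divr_ge0// ltW.
- by rewrite divr_gt0.
- by move=> x T trx; exact: (lyapunov_decay Delta0 al0 be0 mu0 lW gW Wb trx).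
Qed.
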